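(* For every $g\in\mathrm{SU}(1,1)$ we have $\rho_g(\mathcal{T}^\infty)\subseteq\mathcal{T}^\infty$, where $\rho_g$ is the automorphism of the Toeplitz algebra $\mathcal{T}$ with $\rho_g(U)=(\alpha U+\beta)(\bar\beta U+\bar\alpha)^{-1}$ for $g=\begin{bmatrix}\alpha&\beta\\ \bar\beta&\bar\alpha\end{bmatrix}$.
   Context: $H$ is a separable infinite-dimensional complex Hilbert space with a fixed orthonormal basis $\{E_k\}_{k\ge0}$; $P_{k,l}$ is the operator with $P_{k,l}E_l=E_k$ and $P_{k,l}E_m=0$ for $m\ne l$. $\mathcal{K}^\infty$ is the set of operators $c=\sum_{k,l\ge0}c_{k,l}P_{k,l}$ with rapidly decaying coefficients: $\sup_{k,l}(1+k)^M(1+l)^N|c_{k,l}|<\infty$ for all $M,N\ge0$. $U$ is the unilateral shift $UE_k=E_{k+1}$; $\mathcal{T}$ is the C$^*$-algebra generated by $U$ in $B(H)$. For $f\in C^\infty(\mathbb{R}/\mathbb{Z})$ with Fourier series $\sum_nf_ne^{2\pi inx}$, $T(f)=\sum_{n\ge0}f_nU^n+\sum_{n<0}f_n(U^* )^{-n}$. The smooth Toeplitz algebra is $\mathcal{T}^\infty=\{T(f)+c:f\in C^\infty(\mathbb{R}/\mathbb{Z}),\ c\in\mathcal{K}^\infty\}$. $\mathrm{SU}(1,1)$ is the group of complex matrices $\begin{bmatrix}\alpha&\beta\\ \bar\beta&\bar\alpha\end{bmatrix}$ with $|\alpha|^2-|\beta|^2=1$. For such $g$, $\bar\beta U+\bar\alpha$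 is invertible and $W_g=(\alpha U+\beta)(\bar\beta U+\bar\alpha)^{-1}$ satisfies $W_g^*W_g=I$; by Coburn's theorem ($\mathcal{T}$ is the universal C$^*$-algebra generated by an isometry), $U\mapsto W_g$ extends uniquely to a $*$-homomorphism $\rho_g$ of $\mathcal{T}$, which is an automorphism. *)

(* Defs.v *)
From HB Require Import structures.
From mathcomp Require Import all_boot all_order all_algebra complex sesquilinear.
From mathcomp Require Import all_classical all_reals all_analysis.

Set Implicit Arguments.
Unset Strict Implicit.
Unset Printing Implicit Defensive.

Import Order.TTheory GRing.Theory Num.Theory.
Import numFieldNormedType.Exports.
Local Open Scope classical_set_scope.
Local Open Scope complex_scope.
Local Open Scope ring_scope.

(* A Hilbert space is a complete normed complex space [H] with an inner
   product [dot] (linear in the first argument, conjugate-linear in the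
   second) satisfying [hilbert_norm dot]. *)
Definition hilbert_norm (R : realType) (H : completeNormedModType R[i])
    (dot : {dot H for Num.conj}) : Prop :=
  forall x : H, `|x| ^+ 2 = dot x x.

Definition orthonormal_basis (R : realType) (H : completeNormedModType R[i])
    (dot : {dot H for Num.conj}) (E : nat -> H) : Prop :=
  (forall k l, dot (E k) (E l) = (k == l)%:R) /\
  dense [set x : H | exists N (c : nat -> R[i]), x = \sum_(k < N) c k *: E k].

Section BoundedOperators.
Context (R : realType) (H : completeNormedModType R[i]).
Implicit Types (a b : H -> H) (s : nat -> H -> H).

Definition bounded_operator : set (H -> H) :=
  [set a | linear a /\ exists M : R[i], forall x, `|a x| <= M * `|x|].

(* Convergence in operator norm. *)
Definition op_cvg s a : Prop :=
  forall eps : R[i], 0 < eps -> exists N : nat, forall n, (N <= n)%N ->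
    forall x, `|s n x - a x| <= eps * `|x|.

(* The bounded two-sided inverse (junk value 0 if there is none). *)
Definition op_inv a : H -> H :=
  xget (cst 0) [set b | [/\ bounded_operator b, a \o b = id & b \o a = id]].

Context (dot : {dot H for Num.conj}).

(* The Hilbert space adjoint; it exists and is unique when [a] is bounded. *)
Definition adjoint a : H -> H :=
  xget (cst 0) [set b | bounded_operator b /\
    forall x y, dot (a x) y = dot x (b y)].

Definition cstar_subalgebra (A : set (H -> H)) : Prop :=
  [/\ A `<=` bounded_operator /\ A (cst 0),
      forall (z : R[i]) a b, A a -> A b -> A (z *: a + b),
      forall a b, A a -> A b -> A (a \o b),
      forall a, A a -> A (adjoint a)
    & forall s a, (forall n, A (s n)) -> bounded_operator a -> op_cvg s a ->
        A a].

Definition cstar_generated (G : set (H -> H)) : set (H -> H) :=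
  smallest cstar_subalgebra G.

(* Only the values of [rho] on [A] matter. *)
Definition star_automorphism (A : set (H -> H)) (rho : (H -> H) -> (H -> H))
    : Prop :=
  [/\ set_bij A A rho,
      forall (z : R[i]) a b, A a -> A b -> rho (z *: a + b) = z *: rho a + rho b,
      forall a b, A a -> A b -> rho (a \o b) = rho a \o rho b
    & forall a, A a -> rho (adjoint a) = adjoint (rho a)].

End BoundedOperators.

Section PeriodicFunctions.
Context (R : realType).
Implicit Types f : R -> R[i].

(* C^oo(R/Z), as 1-periodic functions on R. *)
Definition smooth_periodic f : Prop :=
  (forall x, f (x + 1) = f x) /\
  (forall (n : nat) (x : R), derivable (derive1n n (fun t => complex.Re (f t))) x 1 /\
                             derivable (derive1n n (fun t => complex.Im (f t))) x 1).

Definition expi (t : R) : R[i] := cos t +i* sin t.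

Definition fourier_coef f (n : int) : R[i] :=
  let g (x : R) := f x * expi (- (2 * pi * n%:~R * x)) in
  (\int[@lebesgue_measure R]_(x in `[0, 1]) complex.Re (g x))%R +i*
  (\int[@lebesgue_measure R]_(x in `[0, 1]) complex.Im (g x))%R.

End PeriodicFunctions.

Section ToeplitzAlgebra.
Context (R : realType) (H : completeNormedModType R[i]).
Context (dot : {dot H for Num.conj}) (E : nat -> H).

(* U: a bounded operator is determined by its values on the basis [E]. *)
Definition unilateral_shift : H -> H :=
  xget (cst 0) [set a | bounded_operator a /\ forall k, a (E k) = E k.+1].

Definition toeplitz_algebra : set (H -> H) :=
  cstar_generated dot [set unilateral_shift].

Definition toeplitz_partial (f : R -> R[i]) (N : nat) : H -> H :=
  fun x => \sum_(n < N) fourier_coef f n%:Z *: iter n unilateral_shift x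
    + \sum_(1 <= n < N)
        fourier_coef f (- n%:Z) *: iter n (adjoint dot unilateral_shift) x.

(* [is_toeplitz f t] : t = T(f). *)
Definition is_toeplitz (f : R -> R[i]) (t : H -> H) : Prop :=
  bounded_operator t /\ op_cvg (toeplitz_partial f) t.

(* The operator P_{k,l}: it sends E_l to E_k and every other E_m to 0. *)
Definition matrix_unit (k l : nat) : H -> H := fun x => dot x (E l) *: E k.

Definition rapid_decay (c : nat -> nat -> R[i]) : Prop :=
  forall M N : nat, exists C : R[i], forall k l : nat,
    (1 + k)%:R ^+ M * (1 + l)%:R ^+ N * `|c k l| <= C.

Definition smooth_compact : set (H -> H) :=
  [set a | bounded_operator a /\ exists c : nat -> nat -> R[i],
    rapid_decay c /\
    op_cvg (fun N x => \sum_(k < N) \sum_(l < N) c k l *: matrix_unit k l x) a].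

Definition smooth_toeplitz : set (H -> H) :=
  [set a | exists f t c,
    [/\ smooth_periodic f, is_toeplitz f t, smooth_compact c & a = t + c]].

(* W_g = (alpha U + beta) (conj(beta) U + conj(alpha))^-1, where the entries of
   [g] are alpha, beta in row 0 and conj(beta), conj(alpha) in row 1. *)
Definition moebius_shift (g : 'M[R[i]]_2) : H -> H :=
  (g 0 0 *: unilateral_shift + g 0 1 *: (id : H -> H))
    \o op_inv (g 1 0 *: unilateral_shift + g 1 1 *: (id : H -> H)).

End ToeplitzAlgebra.

Definition SU11 (R : realType) : set 'M[R[i]]_2 :=
  [set g | [/\ g 1 0 = (g 0 1)^*, g 1 1 = (g 0 0)^*
             & `|g 0 0| ^+ 2 - `|g 0 1| ^+ 2 = 1]].

(* Main.v *)
Require Import Defs.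
From mathcomp Require Import all_boot all_order all_algebra complex sesquilinear.
From mathcomp Require Import all_classical all_reals all_analysis.
From mathcomp Require Import ring lra.
Import Order.TTheory GRing.Theory Num.Theory.
Import numFieldNormedType.Exports.
Local Open Scope classical_set_scope.
Local Open Scope complex_scope.
Local Open Scope ring_scope.

(* The automorphism is implemented by a unitary. Write W = rho(U). The vector
   eta = (conj(beta) U + conj(alpha))^-1 E_0 is a unit vector killed by W^*, the
   vectors F_k = W^k eta form an orthonormal basis, and comparing matrix
   coefficients through the rank-one operators P_{k,l} shows rho(a) = V a V^*
   with V E_k = F_k; in particular rho is norm-continuous. For smooth f the
   operator rho(T(f)) is the norm limit of sum_n f_n W^n (with W^* for n < 0),
   and since W commutes with U it is again a Toeplitz operator, T(f o w), with
   no compact correction. For c in K^oo the matrix of rho(c) is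
   sum_{k,l} c_{k,l} <F_k, E_m> conj(<F_l, E_n>). Both have rapidly decaying
   coefficients because (1 + m)^p |<W^k x, E_m>| = O((1 + k)^p) for the vectors
   x that occur: the number operator z d/dz maps W^k x to
   W^k x' + k W^(k-1) x'' with x', x'' of the same kind. Smooth functions enter
   only through the rapid decay of their Fourier coefficients. *)

Set Implicit Arguments.
Unset Strict Implicit.
Unset Printing Implicit Defensive.

(** * Norms and convergence *)

(** [rho] is given only by algebraic identities on the Toeplitz algebra, while the operators to be
    transformed are norm limits; continuity of [rho] has to be earned. Conjugation by the
    contractions [moebV], [moebVs] gives it by comparing matrix entries, without spectral theory.
    The composed symbol f o w is never formed. [rho t] inherits from its partial sums the identity
    <t U x, U y> = <t x, y>, and an operator with this property is determined by its zeroth column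
    and row. These entries are taken as Fourier coefficients, and a smooth periodic function is
    synthesised from them. In the same way the matrix of [rho c] is read off the operator itself,
    and its decay is proved by passing to the limit. The decay estimate needs no sharpness: a weight
    (1 + m)^p costs only polynomial growth in k, which the rapidly decaying f_n or c_{k,l} absorb.
    The definitions specify the shift and the adjoints by choice. One construction, the partial
    isometry [omap] between orthonormal sequences, supplies witnesses for the shift, its adjoint and
    the adjoint of W, and also gives V. *)

Definition nr (R : realType) (V : normedZmodType R[i]) (x : V) : R :=
  complex.Re `|x|.

Section RealNorm.
Context (R : realType) (V : normedZmodType R[i]).
Implicit Types x y : V.

(** Norms of [R[i]]-modules take values in the partially ordered [R[i]]; this identity moves
    estimates to the totally ordered field [R] and back. *)
Lemma nrE x : (nr x)%:C = `|x|.
Proof. by rewrite /nr RRe_real // ger0_real. Qed.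

Lemma nr_ge0 x : 0 <= nr x.
Proof. by rewrite -ler0c nrE. Qed.

Lemma nr0 : nr (0 : V) = 0.
Proof. by rewrite /nr normr0. Qed.

Lemma nr_eq0 x : nr x = 0 -> x = 0.
Proof. by move=> x0; apply/eqP; rewrite -normr_eq0 -nrE x0. Qed.

Lemma nrD x y : nr (x + y) <= nr x + nr y.
Proof. by rewrite -lecR rmorphD /= !nrE ler_normD. Qed.

Lemma nrN x : nr (- x) = nr x.
Proof. by rewrite /nr normrN. Qed.

Lemma nr_distC x y : nr (x - y) = nr (y - x).
Proof. by rewrite -nrN opprB. Qed.

Lemma nr_sum (I : Type) (r : seq I) (P : pred I) (u : I -> V) :
  nr (\sum_(i <- r | P i) u i) <= \sum_(i <- r | P i) nr (u i).
Proof.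
elim/big_rec2: _ => [|i a b _ ab]; first by rewrite nr0.
by apply: (le_trans (nrD _ _)); rewrite lerD2l.
Qed.

Lemma nr_le_distD x y : nr x <= nr y + nr (x - y).
Proof. by rewrite -{1}(subrK y x) addrC nrD. Qed.

End RealNorm.

Lemma nrM (R : realType) (a b : R[i]) : nr (a * b) = nr a * nr b.
Proof. by apply: complexI; rewrite rmorphM /= !nrE normrM. Qed.

Lemma nrX (R : realType) (a : R[i]) n : nr (a ^+ n) = nr a ^+ n.
Proof. by apply: complexI; rewrite rmorphXn /= !nrE normrX. Qed.

Lemma nrV (R : realType) (a : R[i]) : nr (a^-1) = (nr a)^-1.
Proof. by apply: complexI; rewrite fmorphV /= !nrE normfV. Qed.

Lemma nr_conj (R : realType) (a : R[i]) : nr (Num.conj a) = nr a.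
Proof. by apply: complexI; rewrite !nrE norm_conjC. Qed.

Lemma nr_real (R : realType) (a : R) : nr (a%:C) = `|a|.
Proof. by apply: complexI; rewrite nrE normc_def /= expr0n addr0 sqrtr_sqr. Qed.

Lemma nr_nat (R : realType) n : nr (n%:R : R[i]) = n%:R.
Proof. by apply: complexI; rewrite nrE normr_nat rmorph_nat. Qed.

Lemma sqr_nr (R : realType) (a : R[i]) : (nr a ^+ 2)%:C = a * Num.conj a.
Proof. by rewrite rmorphXn /= nrE normCK. Qed.

Lemma nrZ (R : realType) (V : normedModType R[i]) (a : R[i]) (x : V) :
  nr (a *: x) = nr a * nr x.
Proof. by apply: complexI; rewrite rmorphM /= !nrE normrZ. Qed.

(** Phrased through real distances, so that vectors of [H] and scalars of [R[i]] share one notion of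
    limit that asks for no topology on [V]. *)
Definition cv (R : realType) (V : normedZmodType R[i]) (u : nat -> V) (l : V) :=
  (fun n => nr (u n - l)) @ \oo --> (0 : R).

Lemma squeeze0 (R : realType) (u v : nat -> R) :
  (forall n, 0 <= u n) -> (forall n, u n <= v n) -> v @ \oo --> (0 : R) ->
  u @ \oo --> (0 : R).
Proof.
move=> u0 uv v0; apply: (@squeeze_cvgr _ _ _ _ (cst 0) v) => //.
  by near=> n; rewrite u0 uv.
exact: cvg_cst.
Unshelve. all: by end_near. Qed.

Section Cv.
Context (R : realType) (V : normedZmodType R[i]).
Implicit Types (u v : nat -> V) (l m : V).

Lemma cv_le_near0 u l (b : nat -> R) :
  (forall n, nr (u n - l) <= b n) -> b @ \oo --> (0 : R) -> cv u l.
Proof. by move=> ub b0; apply: (squeeze0 _ ub b0) => n; exact: nr_ge0. Qed.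

Lemma cv_cst l : cv (fun=> l) l.
Proof.
by rewrite /cv; under eq_fun do rewrite subrr nr0; exact: cvg_cst.
Qed.

Lemma cvD' u v l m : cv u l -> cv v m -> cv (fun n => u n + v n) (l + m).
Proof.
move=> ul vm; apply: (@cv_le_near0 _ _ (fun n => nr (u n - l) + nr (v n - m))).
  by move=> n; rewrite opprD addrACA nrD.
by rewrite -[0](addr0 0); apply: cvgD.
Qed.

Lemma cvN' u l : cv u l -> cv (fun n => - u n) (- l).
Proof.
by rewrite /cv; under [in X in _ -> X]eq_fun do rewrite -opprD nrN.
Qed.

Lemma cvB' u v l m : cv u l -> cv v m -> cv (fun n => u n - v n) (l - m).
Proof. by move=> ul vm; apply: cvD' => //; exact: cvN'. Qed.

Lemma cv_nr_le u l (M : R) : (forall n, nr (u n) <= M) -> cv u l -> nr l <= M.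
Proof.
move=> uM ul; rewrite -subr_le0.
apply: (ler_cvg_to (cvg_cst (nr l - M)) ul); near=> n.
rewrite lerBlDl nr_distC; apply: (le_trans (nr_le_distD l (u n))).
by rewrite lerD2r.
Unshelve. all: by end_near. Qed.

Lemma cv_unique u l m : cv u l -> cv u m -> l = m.
Proof.
move=> ul um; apply/eqP; rewrite -subr_eq0; apply/eqP/nr_eq0/eqP.
rewrite eq_le nr_ge0 andbT; apply: (@cv_nr_le (fun=> 0)) => [n|].
  by rewrite nr0.
have := cvB' ul um; rewrite /cv.
by under eq_fun do rewrite subrr.
Qed.

Lemma cv_near_eq u v l : (\forall n \near \oo, u n = v n) -> cv u l -> cv v l.
Proof.
move=> uv; apply: cvg_trans; apply: near_eq_cvg; near=> n.
by congr (nr (_ - _)); near: n.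
Unshelve. all: by end_near. Qed.

Lemma cv_ext u v l : u =1 v -> cv u l -> cv v l.
Proof. by move=> /funext ->. Qed.

End Cv.

Lemma cvZ' (R : realType) (V : normedModType R[i]) (a : R[i]) (u : nat -> V) l :
  cv u l -> cv (fun n => a *: u n) (a *: l).
Proof.
move=> ul; apply: (@cv_le_near0 _ _ _ _ (fun n => nr a * nr (u n - l))).
  by move=> n; rewrite -scalerBr nrZ.
by rewrite -(mulr0 (nr a)); apply: cvgMr.
Qed.

Lemma cvM' (R : realType) (a : R[i]) (u : nat -> R[i]) l :
  cv u l -> cv (fun n => a * u n) (a * l).
Proof.
move=> ul; apply: (@cv_le_near0 _ _ _ _ (fun n => nr a * nr (u n - l))).
  by move=> n; rewrite -mulrBr nrM.
by rewrite -(mulr0 (nr a)); apply: cvgMr.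
Qed.

Lemma cv_conj (R : realType) (u : nat -> R[i]) l :
  cv u l -> cv (fun n => Num.conj (u n)) (Num.conj l).
Proof.
by rewrite /cv; under [in X in _ -> X]eq_fun do rewrite -rmorphB nr_conj.
Qed.

Lemma sum_tail_small (R : realType) (b : nat -> R) B :
  (forall n, 0 <= b n) -> (forall N, \sum_(k < N) b k <= B) ->
  forall e : R, 0 < e -> exists N, forall m n, (N <= m)%N -> (m <= n)%N ->
    \sum_(m <= k < n) b k <= e.
Proof.
move=> b0 bB e e0.
have cb : cvgn (series b).
  apply: nondecreasing_is_cvgn; first exact: nondecreasing_series.
  by exists B => _ [n _ <-]; rewrite /series /= big_mkord; exact: bB.
have /cvgrPdist_le /(_ (e / 2)) [|N _ HN] := cb; first by rewrite divr_gt0.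
exists N => m n Nm mn.
have := HN m Nm; have := HN n (leq_trans Nm mn); rewrite /=.
rewrite -(sub_series_geq _ mn) !ler_norml => /andP[? ?] /andP[? ?].
lra.
Qed.

Section Complete.
Context (R : realType) (H : completeNormedModType R[i]).

Lemma cauchy_cv (u : nat -> H) :
  (forall e : R, 0 < e -> exists N, forall m n, (N <= m)%N -> (m <= n)%N ->
     nr (u n - u m) <= e) ->
  exists l, cv u l.
Proof.
move=> uC.
have : cvg (u @ \oo).
  apply/cauchy_cvgP/cauchy_ballP => e e0.
  (* In the order of [R[i]] a positive element has zero imaginary part. *)
  have eE : (complex.Re e)%:C = e by rewrite RRe_real// gtr0_real.
  have e0' : 0 < complex.Re e by rewrite -ltcR eE.
  have [N HN] := uC (complex.Re e / 2) (divr_gt0 e0' (ltr0n _ 2)).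
  have key m n : (N <= m)%N -> (N <= n)%N -> `|u m - u n| < e.
    move=> Nm Nn; rewrite -eE -nrE ltcR.
    suff : nr (u m - u n) <= complex.Re e / 2 by lra.
    by case/orP: (leq_total m n) => [mn|nm]; [rewrite nr_distC|]; apply: HN.
  rewrite near_map2; near=> m n; rewrite -ball_normE /=; apply: key.
    by near: m; exists N.
  by near: n; exists N.
move=> cu; exists (lim (u @ \oo)).
apply/cvgr0Pnorm_lt => e e0.
have e0' : (0 : R[i]) < e%:C by rewrite ltcR.
have /cvgrPdist_lt /(_ _ e0') := cu.
apply: filterS => n; rewrite -nrE ltcR nr_distC ger0_norm //.
exact: nr_ge0.
Unshelve. all: by end_near. Qed.

Lemma series_cv (u : nat -> H) (b : nat -> R) B :
  (forall n, nr (u n) <= b n) -> (forall N, \sum_(k < N) b k <= B) ->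
  exists l, cv (fun n => \sum_(k < n) u k) l.
Proof.
move=> ub bB; apply: cauchy_cv => e e0.
have b0 n : 0 <= b n by apply: le_trans (ub n); exact: nr_ge0.
have [N HN] := sum_tail_small b0 bB e0.
exists N => m n Nm mn.
rewrite -!(big_mkord xpredT) (big_cat_nat _ mn) //= addrAC subrr add0r.
apply: (le_trans (nr_sum _ _ _)); apply: le_trans (HN _ _ Nm mn).
exact: ler_sum.
Qed.

End Complete.

(** * Bounded operators *)

Section Linear.
Context (R : realType) (H : completeNormedModType R[i]).
Implicit Types (a b : H -> H) (x y : H).

Lemma lin_comp a b : linear a -> linear b -> linear (a \o b).
Proof. by move=> la lb z x y /=; rewrite lb la. Qed.

Lemma linD a x y : linear a -> a (x + y) = a x + a y.
Proof. by move=> la; have := la 1 x y; rewrite !scale1r. Qed.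

Lemma lin0 a : linear a -> a 0 = 0.
Proof. by move=> la; apply: (addrI (a 0)); rewrite -linD // !addr0. Qed.

Lemma linZ a z x : linear a -> a (z *: x) = z *: a x.
Proof. by move=> la; have := la z x 0; rewrite !addr0 lin0 // addr0. Qed.

Lemma linN a x : linear a -> a (- x) = - a x.
Proof. by move=> la; rewrite -scaleN1r linZ // scaleN1r. Qed.

Lemma linB a x y : linear a -> a (x - y) = a x - a y.
Proof. by move=> la; rewrite linD // linN. Qed.

Lemma lin_sum a (n : nat) (u : 'I_n -> H) : linear a ->
  a (\sum_(k < n) u k) = \sum_(k < n) a (u k).
Proof.
by move=> la; apply: big_morph; [move=> x y; exact: linD|exact: lin0].
Qed.

(* The operator bound with a real constant, avoiding the partial order of
   [R[i]]. *)
Definition bop (M : R) a := [/\ linear a, 0 <= M & forall x, nr (a x) <= M * nr x].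

Lemma bop_bounded M a : bop M a -> bounded_operator a.
Proof.
move=> [la M0 aM]; split => //; exists M%:C => x.
by rewrite -!nrE -rmorphM /= lecR.
Qed.

(** The given constant may fail to be real when [H] is trivial. Since [M * |x|] dominates a norm it
    is nonnegative, hence equal to its own modulus, and [nr M] serves instead. *)
Lemma bounded_bop a : bounded_operator a -> exists M, bop M a.
Proof.
move=> [la [M aM]]; exists (nr M); split => // [|x]; first exact: nr_ge0.
rewrite -lecR rmorphM /= !nrE; apply: (le_trans (aM x)).
have := le_trans (normr_ge0 (a x)) (aM x).
by move=> /ger0_norm <-; rewrite normrM normr_id.
Qed.

Lemma bop_cv M a u l : bop M a -> cv u l -> cv (fun n => a (u n)) (a l).
Proof.
move=> [la _ aM] ul; apply: (@cv_le_near0 _ _ _ _ (fun n => M * nr (u n - l))).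
  by move=> n; rewrite -linB.
by rewrite -(mulr0 M); apply: cvgMr.
Qed.

Lemma bop_id : bop 1 (@id H).
Proof. by split => // x; rewrite mul1r. Qed.

Lemma bop_comp M N a b : bop M a -> bop N b -> bop (M * N) (a \o b).
Proof.
move=> [la M0 aM] [lb N0 bN]; split; [exact: lin_comp|exact: mulr_ge0|move=> x /=].
by apply: (le_trans (aM _)); rewrite -mulrA ler_wpM2l.
Qed.

Lemma bop_lin z M N a b : bop M a -> bop N b -> bop (nr z * M + N) (z *: a + b).
Proof.
move=> [la M0 aM] [lb N0 bN]; split.
- move=> t x y; rewrite !fctE la lb !scalerDr !scalerA (mulrC z t).
  by rewrite addrACA.
- by rewrite addr_ge0 // mulr_ge0 // nr_ge0.
- move=> x; rewrite !fctE (le_trans (nrD _ _)) // nrZ mulrDl lerD //.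
  by rewrite -mulrA ler_wpM2l // nr_ge0.
Qed.

Lemma bop_iter a n : bop 1 a -> bop 1 (iter n a).
Proof.
move=> ba; elim: n => [|n IH]; first exact: bop_id.
by have := bop_comp ba IH; rewrite mulr1.
Qed.

Lemma bop_limit M (s : nat -> H -> H) a : 0 <= M -> (forall n, linear (s n)) ->
  (forall n x, nr (s n x) <= M * nr x) ->
  (forall x, cv (s^~ x) (a x)) -> bop M a.
Proof.
move=> M0 sl sM sa; split => // [z x y|x]; last by apply: cv_nr_le (sa x).
apply: (cv_unique (sa _)); apply: cv_ext (cvD' (cvZ' z (sa x)) (sa y)).
by move=> n; rewrite sl.
Qed.

Lemma op_cvgP (s : nat -> H -> H) a :
  op_cvg s a <-> forall e : R, 0 < e -> exists N, forall n, (N <= n)%N ->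
    forall x, nr (s n x - a x) <= e * nr x.
Proof.
split=> sa e e0.
  have [|N HN] := sa e%:C; first by rewrite ltcR.
  by exists N => n Nn x; rewrite -lecR rmorphM /= !nrE HN.
have eE : (complex.Re e)%:C = e by rewrite RRe_real// gtr0_real.
have [|N HN] := sa (complex.Re e); first by rewrite -ltcR eE.
by exists N => n Nn x; rewrite -eE -!nrE -rmorphM /= lecR HN.
Qed.

Lemma op_cvg_cv (s : nat -> H -> H) a x : op_cvg s a -> cv (s^~ x) (a x).
Proof.
move=> /op_cvgP sa; apply/cvgr0Pnorm_le => e e0.
have x1 : 0 < nr x + 1 by rewrite ltr_wpDl // nr_ge0.
have [|N HN] := sa (e / (nr x + 1)); first by rewrite divr_gt0.
exists N => // n Nn; rewrite ger0_norm ?nr_ge0 // (le_trans (HN _ Nn x)) //.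
by rewrite mulrAC ler_pdivrMr // ler_wpM2l ?(ltW e0) // lerDl.
Qed.

(** The Weierstrass test: absolute convergence gives the limit at each vector, and a tail bound
    proportional to [nr x] upgrades it to operator norm. *)
Lemma op_series (u : nat -> H -> H) (b : nat -> R) B :
  (forall n, bop (b n) (u n)) -> (forall N, \sum_(k < N) b k <= B) ->
  exists a, bop B a /\ op_cvg (fun N x => \sum_(k < N) u k x) a.
Proof.
move=> ub bB.
have b0 n : 0 <= b n by case: (ub n).
have ex x : exists l, cv (fun n => \sum_(k < n) u k x) l.
  apply: (@series_cv _ _ (u^~ x) (fun k => b k * nr x) (B * nr x)) => [n|N].
    by case: (ub n).
  by rewrite -mulr_suml ler_wpM2r // nr_ge0.
have [a sa] := choice ex.
have tail m n x : (m <= n)%N ->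
    nr (\sum_(k < n) u k x - \sum_(k < m) u k x) <= (\sum_(m <= k < n) b k) * nr x.
  move=> mn; rewrite -!(big_mkord xpredT (u^~ x)) (big_cat_nat _ mn) //= addrAC subrr add0r.
  apply: (le_trans (nr_sum _ _ _)); rewrite mulr_suml ler_sum // => i _.
  by case: (ub i).
exists a; split.
  apply: (@bop_limit B (fun N x => \sum_(k < N) u k x) a) => [|n z x y|n x|x]; last exact: sa.
  - by apply: le_trans (bB 0%N); rewrite big_ord0.
  - rewrite scaler_sumr -big_split /=; apply: eq_bigr => i _.
    by case: (ub i) => li _ _; rewrite li.
  - have := @tail 0%N n x; rewrite big_ord0 subr0 => /(_ (leq0n n)) /le_trans; apply.
    by rewrite big_mkord ler_wpM2r // nr_ge0.
apply/op_cvgP => e e0.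
have [N HN] := sum_tail_small b0 bB e0.
exists N => n Nn x; rewrite nr_distC.
have lm := cvB' (sa x) (cv_cst (\sum_(k < n) u k x)).
(* [cv_nr_le] wants a bound at every index; replacing [m] by [maxn m n] makes the tail estimate
   available for all [m] and leaves the limit unchanged. *)
apply: (@cv_nr_le _ _ (fun m => \sum_(k < maxn m n) u k x - \sum_(k < n) u k x)).
  move=> m; apply: (le_trans (tail _ _ _ (leq_maxr m n))).
  by rewrite ler_wpM2r ?nr_ge0 // HN // leq_maxr.
apply: cv_near_eq lm; exists n => // m nm.
by rewrite (maxn_idPl nm).
Qed.

End Linear.

(** * Hilbert space geometry *)

Section Dot.
Context (R : realType) (H : completeNormedModType R[i]).
Context (dot : {dot H for Num.conj}) (Hdot : hilbert_norm dot).
Implicit Types (a b : H -> H) (x y : H).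

Lemma dotC x y : dot x y = Num.conj (dot y x).
Proof. by rewrite (@hermitian_subproof _ _ _ _ dot) expr0 mul1r. Qed.

Lemma dotDl x y z : dot (x + y) z = dot x z + dot y z.
Proof. exact: linearDl. Qed.
Lemma dotDr x y z : dot z (x + y) = dot z x + dot z y.
Proof. exact: linearDr. Qed.
Lemma dotBl x y z : dot (x - y) z = dot x z - dot y z.
Proof. exact: linearBl. Qed.
Lemma dotBr x y z : dot z (x - y) = dot z x - dot z y.
Proof. exact: linearBr. Qed.
Lemma dotZl c x z : dot (c *: x) z = c * dot x z.
Proof. exact: linearZl_LR. Qed.
Lemma dotZr c x z : dot z (c *: x) = Num.conj c * dot z x.
Proof. exact: linearZr_LR. Qed.
Lemma dot0l z : dot 0 z = 0.
Proof. exact: linear0l. Qed.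
Lemma dot0r z : dot z 0 = 0.
Proof. exact: linear0r. Qed.

Lemma dot_suml n (u : 'I_n -> H) y :
  dot (\sum_(k < n) u k) y = \sum_(k < n) dot (u k) y.
Proof. exact: linear_sumlz. Qed.

Lemma dot_nr x : dot x x = (nr x ^+ 2)%:C.
Proof. by rewrite -Hdot -nrE rmorphXn. Qed.

Lemma cauchy_schwarz x y : nr (dot x y) <= nr x * nr y.
Proof.
have [->|y0] := eqVneq y 0; first by rewrite dot0r !nr0 mulr0.
have ny : 0 < nr y.
  by rewrite lt_neqAle nr_ge0 andbT eq_sym; apply: contra y0 => /eqP/nr_eq0/eqP.
(* Expanding the squared norm of [B *: x - a *: y] gives [B] times the difference to be shown
   nonnegative; no division occurs. *)
pose B := dot y y; pose a := dot x y.
have : (0 : R[i]) <= (nr (B *: x - a *: y) ^+ 2)%:C by rewrite lecR sqr_ge0.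
rewrite -dot_nr !(dotBl, dotBr, dotZl, dotZr) (dotC y x) -/a.
have -> : Num.conj B = B by rewrite /B dot_nr; apply/CrealP; rewrite complex_real.
rewrite -/B (_ : _ - _ = B * (B * dot x x - a * Num.conj a)); last by ring.
rewrite -sqr_nr /B !dot_nr -!(rmorphM, rmorphB) /= lecR.
rewrite pmulr_rge0 ?exprn_gt0 // subr_ge0 -exprMn ler_pXn2r ?nnegrE ?mulr_ge0 ?nr_ge0 //.
by rewrite mulrC.
Qed.

Lemma cv_dotl u l y : cv u l -> cv (fun n => dot (u n) y) (dot l y).
Proof.
move=> ul; apply: (@cv_le_near0 _ _ _ _ (fun n => nr (u n - l) * nr y)) => [n|].
  by rewrite -dotBl cauchy_schwarz.
by rewrite -(mul0r (nr y)); apply: cvgMl.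
Qed.

Lemma cv_dotr u l y : cv u l -> cv (fun n => dot y (u n)) (dot y l).
Proof.
move=> /(cv_dotl y)/cv_conj; rewrite -dotC.
by apply: cv_ext => n; rewrite -dotC.
Qed.

Lemma nr_pythagoras x y : dot x y = 0 -> nr (x + y) ^+ 2 = nr x ^+ 2 + nr y ^+ 2.
Proof.
move=> xy; apply: complexI; rewrite -dot_nr !(dotDl, dotDr) (dotC y x) xy.
by rewrite rmorph0 addr0 add0r !dot_nr rmorphD.
Qed.

Definition ortho (F : nat -> H) := forall k l, dot (F k) (F l) = (k == l)%:R.

Lemma ortho_nr F k : ortho F -> nr (F k) = 1.
Proof.
move=> oF; apply/eqP; rewrite -(@pexpr_eq1 _ _ 2) ?nr_ge0 //; apply/eqP.
by apply: complexI; rewrite -dot_nr oF eqxx.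
Qed.

Lemma dot_ortho_sum F (c : nat -> R[i]) n l : ortho F ->
  dot (\sum_(k < n) c k *: F k) (F l) = if (l < n)%N then c l else 0.
Proof.
move=> oF; rewrite dot_suml; under eq_bigr do rewrite dotZl oF.
case: ltnP => [ln|nl].
  rewrite (bigD1 (Ordinal ln)) //= eqxx mulr1 big1 ?addr0 // => i.
  by rewrite -val_eqE /= => /negbTE ->; rewrite mulr0.
rewrite big1 // => i _; rewrite [_ == _](negbTE _) ?mulr0 //.
by rewrite neq_ltn (leq_trans (ltn_ord i) nl).
Qed.

Lemma nr_ortho_sum F (c : nat -> R[i]) m n : ortho F ->
  nr (\sum_(m <= k < n) c k *: F k) ^+ 2 = \sum_(m <= k < n) nr (c k) ^+ 2.
Proof.
move=> oF; elim: n => [|n IH]; first by rewrite !big_geq // nr0 expr0n.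
case: (leqP m n) => [mn|nm]; last by rewrite !big_geq // nr0 expr0n.
rewrite !big_nat_recr //= nr_pythagoras; first by rewrite IH nrZ (ortho_nr _ oF) mulr1.
rewrite dotZr; have -> : \sum_(m <= k < n) c k *: F k =
  \sum_(k < n) c k *: F k - \sum_(k < m) c k *: F k.
  rewrite -!(big_mkord xpredT (fun k => c k *: F k)) [in RHS](big_cat_nat _ mn) //=.
  by rewrite addrAC subrr add0r.
by rewrite dotBl !dot_ortho_sum // ltnn ltnNge mn subrr mulr0.
Qed.

Lemma bessel F x n : ortho F -> \sum_(k < n) nr (dot x (F k)) ^+ 2 <= nr x ^+ 2.
Proof.
move=> oF; pose s := \sum_(k < n) dot x (F k) *: F k.
have xs : dot (x - s) s = 0.
  rewrite {2}/s; have -> : dot (x - s) (\sum_(k < n) dot x (F k) *: F k) =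
    Num.conj (dot (\sum_(k < n) dot x (F k) *: F k) (x - s)) by rewrite -dotC.
  rewrite dot_suml big1 ?rmorph0 // => i _.
  by rewrite dotZl (dotC (F i)) dotBl (dot_ortho_sum (fun k => dot x (F k)) _ _ oF)
    ltn_ord subrr rmorph0 mulr0.
rewrite -(big_mkord xpredT (fun k => nr (dot x (F k)) ^+ 2)).
rewrite -(nr_ortho_sum (fun k => dot x (F k)) _ _ oF) big_mkord -/s.
by rewrite -[X in _ <= nr X ^+ 2](subrK s x) nr_pythagoras // lerDr sqr_ge0.
Qed.

Lemma ortho_sum_cv F (c : nat -> R[i]) B : ortho F ->
  (forall n, \sum_(k < n) nr (c k) ^+ 2 <= B) ->
  exists l, cv (fun n => \sum_(k < n) c k *: F k) l.
Proof.
move=> oF cB; apply: cauchy_cv => e e0.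
have [N HN] := @sum_tail_small _ (fun k => nr (c k) ^+ 2) _ (fun n => sqr_ge0 _)
  cB _ (exprn_gt0 2 e0).
exists N => m n Nm mn.
rewrite -!(big_mkord xpredT (fun k => c k *: F k)) (big_cat_nat _ mn) //=.
rewrite addrAC subrr add0r -(@ler_pXn2r _ 2) ?nnegrE ?nr_ge0 ?(ltW e0) //.
by rewrite nr_ortho_sum //; exact: HN.
Qed.

(* The partial isometry taking [G k] to [F k]. The limit exists when [G] and
   [F] are orthonormal; the value is junk otherwise. *)
Definition omap (G F : nat -> H) : H -> H := fun x =>
  xget 0 [set l | cv (fun n => \sum_(k < n) dot x (G k) *: F k) l].

Section Omap.
Variables (G F : nat -> H).
Hypotheses (oG : ortho G) (oF : ortho F).

Lemma omap_cv x : cv (fun n => \sum_(k < n) dot x (G k) *: F k) (omap G F x).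
Proof.
rewrite /omap; case: xgetP => [l -> //|].
have [l ul] := @ortho_sum_cv F (fun k => dot x (G k)) _ oF (fun n => bessel x n oG).
by move=> /(_ l).
Qed.

Lemma omap_bop : bop 1 (omap G F).
Proof.
apply: (@bop_limit _ _ 1 (fun n x => \sum_(k < n) dot x (G k) *: F k)) => //.
- move=> n z x y; rewrite scaler_sumr -big_split /=; apply: eq_bigr => i _.
  by rewrite dotDl dotZl scalerDl scalerA.
- move=> n x; rewrite mul1r -(@ler_pXn2r _ 2) ?nnegrE ?nr_ge0 //.
  rewrite -(big_mkord xpredT (fun k => dot x (G k) *: F k)).
  by rewrite (nr_ortho_sum (fun k => dot x (G k))) // big_mkord bessel.
- exact: omap_cv.
Qed.

Lemma dot_omap x l : dot (omap G F x) (F l) = dot x (G l).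
Proof.
apply: (cv_unique (cv_dotl (F l) (omap_cv x))).
apply: cv_near_eq (cv_cst _); exists l.+1 => // n ln.
by rewrite (dot_ortho_sum (fun k => dot x (G k))) // ln.
Qed.

Lemma omapE k : omap G F (G k) = F k.
Proof.
apply: (cv_unique (omap_cv (G k))).
apply: cv_near_eq (cv_cst _); exists k.+1 => // n kn.
rewrite (bigD1 (Ordinal kn)) //= oG eqxx scale1r big1 ?addr0 // => i.
by rewrite -val_eqE /= oG eq_sym => /negbTE ->; rewrite scale0r.
Qed.

End Omap.

(** Exchanging the two sequences yields the adjoint explicitly, so no representation theorem for
    functionals is called upon. *)
Lemma omap_adj G F x y : ortho G -> ortho F ->
  dot (omap G F x) y = dot x (omap F G y).
Proof.
move=> oG oF; apply: (cv_unique (cv_dotl y (omap_cv oG oF x))).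
apply: cv_ext (cv_dotr x (omap_cv oF oG y)) => n.
rewrite dotC !dot_suml rmorph_sum; apply: eq_bigr => i _.
by rewrite !dotZl rmorphM /= -!dotC mulrC.
Qed.

Lemma adjointE a b : bounded_operator b -> (forall x y, dot (a x) y = dot x (b y)) ->
  adjoint dot a = b.
Proof.
move=> bb ab; rewrite /adjoint; case: xgetP => [c _ [bc ac]|]; last first.
  by move=> /(_ b) [].
apply/funext => y; apply/eqP; rewrite -subr_eq0 -(dnorm_eq0 dot); apply/eqP.
by rewrite dotBr -ac ab subrr.
Qed.

Definition total (F : nat -> H) := forall x, (forall k, dot x (F k) = 0) -> x = 0.

(** A vector [x] orthogonal to a finite combination [y] satisfies |x - y|^2 = |x|^2 + |y|^2, so |x|
    is at most |x - y|, which density makes arbitrarily small. *)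
Lemma basis_total E : orthonormal_basis dot E -> total E.
Proof.
move=> [oE dE] x x0; apply: nr_eq0; apply/eqP; rewrite eq_le nr_ge0 andbT.
apply/ler_addgt0Pl => e e0; rewrite addr0.
have [|y [yx [N [c yE]]]] := dE (ball x e%:C) _ (ball_open _ _); last first.
  move: yx; rewrite -ball_normE /= -nrE ltcR => /ltW; apply: le_trans.
  rewrite -(@ler_pXn2r _ 2) ?nnegrE ?nr_ge0 // nr_pythagoras ?lerDl ?sqr_ge0 //.
  rewrite yE -scaleN1r dotZr dotC dot_suml big1 ?rmorph0 ?mulr0 // => i _.
  by rewrite dotZl dotC x0 rmorph0 mulr0.
by exists x; apply: ballxx; rewrite ltcR.
Qed.

Lemma total_ext E x y : total E -> (forall k, dot x (E k) = dot y (E k)) -> x = y.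
Proof.
move=> tE xy; apply/eqP; rewrite -subr_eq0; apply/eqP; apply: tE => k.
by rewrite dotBl xy subrr.
Qed.

Lemma total_expand E x : ortho E -> total E -> omap E E x = x.
Proof. by move=> oE tE; apply: (total_ext tE) => k; rewrite dot_omap. Qed.

Lemma bop_ext E M N a b : ortho E -> total E -> bop M a -> bop N b ->
  (forall k, a (E k) = b (E k)) -> a = b.
Proof.
move=> oE tE ba bb ab; apply/funext => x.
have cx := omap_cv oE oE x; rewrite total_expand // in cx.
apply: (cv_unique (bop_cv ba cx)); apply: cv_ext (bop_cv bb cx) => n.
rewrite !lin_sum; [|by case: ba|by case: bb]; apply: eq_bigr => i _.
rewrite !linZ ?ab //; [by case: ba|by case: bb].
Qed.

End Dot.

(** * The shift and its Moebius transform *)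

Section Neumann.
Context (R : realType) (H : completeNormedModType R[i]).

Lemma geom_cvg0 (q : R) : 0 <= q -> q < 1 -> (fun n => q ^+ n) @ \oo --> (0 : R).
Proof. by move=> q0 q1; apply: cvg_expr; rewrite ger0_norm. Qed.

Lemma geom_sum_le (q : R) N : 0 <= q -> q < 1 -> \sum_(k < N) q ^+ k <= (1 - q)^-1.
Proof.
move=> q0 q1; have q1' : 0 < 1 - q by rewrite subr_gt0.
rewrite -[_^-1]mul1r ler_pdivlMr // mulrC -opprB mulNr -subrX1 opprB.
by rewrite lerBlDr lerDl exprn_ge0.
Qed.

(** [S] is the geometric series for (1 - qT)^-1. The last clause keeps the series itself, which
    later shows that [S] preserves closed subspaces invariant under [T]. *)
Lemma neumann (T : H -> H) (q : R[i]) : bop 1 T -> nr q < 1 ->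
  exists S, [/\ exists M, bop M S,
    forall x, S x - q *: T (S x) = x,
    forall x, S (x - q *: T x) = x &
    forall x, cv (fun n => \sum_(k < n) q ^+ k *: iter k T x) (S x)].
Proof.
move=> bT q1; have q0 := nr_ge0 q; have [lT _ _] := bT.
have bu n : bop (nr q ^+ n) (q ^+ n *: iter n T).
  have [l _ M] := bop_iter n bT; split; [|exact: exprn_ge0|].
    by move=> z x y; rewrite !fctE l scalerDr !scalerA (mulrC z).
  by move=> x; rewrite nrZ nrX ler_wpM2l ?exprn_ge0 //; have := M x; rewrite mul1r.
have [S [bS SN]] := op_series bu (fun N => geom_sum_le N q0 q1).
have cS x := op_cvg_cv x SN.
have tele (f : nat -> H) n : \sum_(k < n) f k - \sum_(k < n) f k.+1 = f 0%N - f n.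
  rewrite -sumrB; elim: n => [|n IH]; first by rewrite big_ord0 subrr.
  by rewrite big_ord_recr /= IH addrA subrK.
have lim0 x : cv (fun n => x - q ^+ n *: iter n T x) x.
  apply: (@cv_le_near0 _ _ _ _ (fun n => nr q ^+ n * nr x)) => [n|].
    by rewrite addrAC subrr add0r nrN; case: (bu n) => _ _ bn; exact: bn.
  by rewrite -(mul0r (nr x)); apply: cvgMl; exact: geom_cvg0.
have lS : linear S by case: bS.
exists S; split; [by exists (1 - nr q)^-1| | |exact: cS] => x.
  apply: (@cv_unique _ _ (fun n => x - q ^+ n *: iter n T x)); last exact: lim0.
  apply: cv_ext (cvB' (cS x) (cvZ' q (bop_cv bT (cS x)))) => n.
  transitivity (q ^+ 0 *: iter 0 T x - q ^+ n *: iter n T x); last by rewrite scale1r.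
  rewrite -(tele (fun k => q ^+ k *: iter k T x)); congr (_ - _).
  rewrite lin_sum // scaler_sumr; apply: eq_bigr => i _.
  by rewrite !fctE linZ // scalerA exprS iterS.
apply: (@cv_unique _ _ (fun n => x - q ^+ n *: iter n T x)); last exact: lim0.
apply: cv_ext (cS _) => n.
transitivity (q ^+ 0 *: iter 0 T x - q ^+ n *: iter n T x); last by rewrite scale1r.
rewrite -(tele (fun k => q ^+ k *: iter k T x)) -sumrB; apply: eq_bigr => i _.
have [li _ _] := bop_iter i bT.
by rewrite !fctE linB // linZ // scalerBr scalerA -exprSr iterSr.
Qed.

End Neumann.

Section Shift.
Context (R : realType) (H : completeNormedModType R[i]).
Context (dot : {dot H for Num.conj}) (Hdot : hilbert_norm dot).
Context (E : nat -> H) (HE : orthonormal_basis dot E).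

Let oE : ortho dot E. Proof. by case: HE. Qed.
Let tE : total dot E. Proof. exact: basis_total HE. Qed.

Let oES : ortho dot (E \o S).
Proof. by move=> k l; rewrite /= oE. Qed.

(** As instances of [omap] the shift and its adjoint come with norm bounds and the adjoint relation;
    [shiftU_unilateral] and [adjoint_shiftU] identify them with the operators fixed by choice. *)
Definition shiftU := omap dot E (E \o S).
Definition shiftUs := omap dot (E \o S) E.
Local Notation U := shiftU.
Local Notation Us := shiftUs.

Lemma shiftU_bop : bop 1 U. Proof. exact: omap_bop. Qed.
Lemma shiftUs_bop : bop 1 Us. Proof. exact: omap_bop. Qed.

Lemma shiftUE k : U (E k) = E k.+1.
Proof. exact: (omapE Hdot oE oES). Qed.

Lemma shiftU_unilateral : unilateral_shift E = U.
Proof.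
rewrite /unilateral_shift; case: xgetP => [a _ [ba aE]|/(_ U)[]].
  have [M bM] := bounded_bop ba.
  by apply: (bop_ext Hdot oE tE bM shiftU_bop) => k; rewrite aE shiftUE.
by split; [exact: bop_bounded shiftU_bop|exact: shiftUE].
Qed.

Lemma shiftU_adj x y : dot (U x) y = dot x (Us y).
Proof. exact: (omap_adj Hdot). Qed.

Lemma adjoint_shiftU : adjoint dot U = Us.
Proof. apply: adjointE; [exact: bop_bounded shiftUs_bop|exact: shiftU_adj]. Qed.

Lemma dot_shiftUS x k : dot (U x) (E k.+1) = dot x (E k).
Proof. exact: (dot_omap Hdot oE oES). Qed.

Lemma shiftUsK x : Us (U x) = x.
Proof.
by apply: (total_ext tE) => k; rewrite (dot_omap Hdot oES oE) /= dot_shiftUS.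
Qed.

Lemma shiftUs0 : Us (E 0%N) = 0.
Proof.
by apply: tE => k; rewrite (dot_omap Hdot oES oE) /= oE.
Qed.

Lemma dot_shiftU0 x : dot (U x) (E 0%N) = 0.
Proof. by rewrite shiftU_adj shiftUs0 dot0r. Qed.

Lemma dot_shiftUU x y : dot (U x) (U y) = dot x y.
Proof. by rewrite shiftU_adj shiftUsK. Qed.

Lemma dot_shiftUs x k : dot (Us x) (E k) = dot x (E k.+1).
Proof. exact: (dot_omap Hdot oES oE). Qed.

(** This is 1 - U U^* with 1 written as U^* U: a linear combination of words in the generators, in
    the shape [z *: a + b] that closure of the algebra and linearity of [rho] accept. *)
Lemma matrix_unit00 : matrix_unit dot E 0 0 = (-1) *: (U \o Us) + (Us \o U).
Proof.
apply/funext => x; rewrite /matrix_unit !fctE /= shiftUsK.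
apply: (total_ext tE) => -[|k]; rewrite dotDl !dotZl oE.
  by rewrite dot_shiftU0 mulr0 add0r mulr1.
by rewrite dot_shiftUS dot_shiftUs mulN1r addNr mulr0.
Qed.

Lemma iter_shiftUE n k : iter n U (E k) = E (n + k)%N.
Proof. by elim: n => //= n ->; rewrite shiftUE. Qed.

Section Moebius.
Variables (al be : R[i]).
Hypothesis det1 : nr al ^+ 2 - nr be ^+ 2 = 1.

Let det1' : al * Num.conj al - be * Num.conj be = 1.
Proof. by rewrite -!sqr_nr -rmorphB /= det1. Qed.

Let al0 : al != 0.
Proof.
apply/eqP => a0; have := sqr_ge0 (nr be); have := det1.
rewrite a0 nr0 expr0n sub0r => d1; rewrite -oppr_le0 d1.
by rewrite ler10.
Qed.

Definition moebA : H -> H := Num.conj be *: U + Num.conj al *: (id : H -> H).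
Definition moebB : H -> H := al *: U + be *: (id : H -> H).
Definition moebR : H -> H := op_inv moebA.
Definition moebW : H -> H := moebB \o moebR.

Let lU : linear U. Proof. by case: shiftU_bop. Qed.

(** [moebA] is conj(al) times 1 - qU with q = -conj(be)/conj(al), and |q| < 1 because |al|^2 -
    |be|^2 = 1; the Neumann series inverts it, and two-sided inverses are unique. *)
Lemma moebR_spec : [/\ exists M, bop M moebR, forall x, moebA (moebR x) = x
  & forall x, moebR (moebA x) = x].
Proof.
have ab : nr (- Num.conj be / Num.conj al) < 1.
  rewrite nrM nrN nrV !nr_conj ltr_pdivrMr ?mul1r.
    rewrite -(@ltr_pXn2r _ 2) ?nnegrE ?nr_ge0 //.
    by have := det1; lra.
  rewrite lt_neqAle nr_ge0 andbT eq_sym; apply: contra al0 => /eqP.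
  by move=> /nr_eq0 ->.
have ca0 : Num.conj al != 0 by rewrite conjC_eq0.
have [T [[M bT] T1 T2 _]] := neumann shiftU_bop ab.
have lT : linear T by case: bT.
pose T' x := (Num.conj al)^-1 *: T x.
have bT' : bounded_operator T'.
  apply: (@bop_bounded _ _ (nr (Num.conj al)^-1 * M)).
  case: bT => _ M0 TM; split; [|by rewrite mulr_ge0 ?nr_ge0|].
    by move=> z x y; rewrite /T' lT scalerDr !scalerA (mulrC z).
  by move=> x; rewrite nrZ -mulrA ler_wpM2l ?nr_ge0.
have AT x : moebA (T' x) = x.
  rewrite /moebA /T' !fctE (linZ _ _ lU) -[in RHS](T1 x) mulNr scaleNr opprK [RHS]addrC.
  by rewrite !scalerA mulfV // scale1r.
have TA x : T' (moebA x) = x.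
  rewrite /T' -[RHS]T2 -linZ //; congr (T _).
  rewrite /moebA !fctE scalerDr !scalerA mulVf // scale1r addrC.
  by rewrite mulNr scaleNr opprK [in RHS]mulrC.
have <- : T' = moebR.
  rewrite /moebR /op_inv; case: xgetP => [b _ [_ bA Ab]|/(_ T')[]].
    by apply/funext => x; rewrite -[x in LHS](congr1 (@^~ x) bA) /= TA.
  by split => //; apply/funext => x /=.
by split => //; exact: bounded_bop.
Qed.

Lemma moebAR x : moebA (moebR x) = x. Proof. by case: moebR_spec. Qed.
Lemma moebRA x : moebR (moebA x) = x. Proof. by case: moebR_spec. Qed.
Lemma moebR_lin : linear moebR. Proof. by case: moebR_spec => -[M []]. Qed.

Let lR := moebR_lin.
Lemma moebBE x : moebB x = al *: U x + be *: x. Proof. by []. Qed.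
Lemma moebAE x : moebA x = Num.conj be *: U x + Num.conj al *: x. Proof. by []. Qed.

Lemma moebUR x : U (moebR x) = moebR (U x).
Proof.
rewrite -[LHS]moebRA; congr moebR; rewrite -[in RHS](moebAR x) !moebAE.
by rewrite (linD _ _ lU) !(linZ _ _ lU).
Qed.

Lemma moebWE x : moebW x = al *: U (moebR x) + be *: moebR x. Proof. by []. Qed.

Lemma moebUW x : U (moebW x) = moebW (U x).
Proof. by rewrite !moebWE (linD _ _ lU) !(linZ _ _ lU) !moebUR. Qed.

Lemma moebRW x : moebR (moebW x) = moebW (moebR x).
Proof. by rewrite !moebWE (linD _ _ lR) !(linZ _ _ lR) -!moebUR. Qed.

(** The operator form of |al z + be| = |conj(be) z + conj(al)| on the unit circle: since U is
    isometric, both sides have the diagonal factor |al|^2 + |be|^2 and the same cross terms. *)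
Lemma dot_moebBA x y : dot (moebB x) (moebB y) = dot (moebA x) (moebA y).
Proof.
rewrite !moebBE !moebAE !(dotDl, dotDr, dotZl, dotZr) !dot_shiftUU !conjCK.
by ring.
Qed.

Lemma dot_moebW x y : dot (moebW x) (moebW y) = dot x y.
Proof. by rewrite /moebW /= dot_moebBA !moebAR. Qed.

Lemma nr_moebW x : nr (moebW x) = nr x.
Proof.
apply/eqP; rewrite -(@eqrXn2 _ 2) ?nr_ge0 //; apply/eqP/complexI.
by rewrite -!(dot_nr Hdot) dot_moebW.
Qed.

Lemma moebW_lin : linear moebW.
Proof.
move=> z x y; rewrite !moebWE lR lU !scalerDr !scalerA (mulrC al) (mulrC be).
by rewrite addrACA.
Qed.
Let lW := moebW_lin.

Lemma moebW_bop : bop 1 moebW.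
Proof. by split => // x; rewrite nr_moebW mul1r. Qed.

Let oWE : ortho dot (moebW \o E).
Proof. by move=> k l; rewrite /= dot_moebW oE. Qed.

Definition moebWs := omap dot (moebW \o E) E.

Lemma moebWs_bop : bop 1 moebWs. Proof. exact: omap_bop. Qed.

Lemma moebW_adj x y : dot (moebW x) y = dot x (moebWs y).
Proof.
rewrite -(omap_adj Hdot _ _ oE oWE); congr (dot _ y).
apply: (congr1 (@^~ x)).
apply: (bop_ext Hdot oE tE moebW_bop (omap_bop Hdot oE oWE)) => k.
by rewrite (omapE Hdot oE oWE).
Qed.

Lemma adjoint_moebW : adjoint dot moebW = moebWs.
Proof. apply: adjointE; [exact: bop_bounded moebWs_bop|exact: moebW_adj]. Qed.

Lemma moebWsK x : moebWs (moebW x) = x.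
Proof.
by apply: (total_ext tE) => k; rewrite (dot_omap Hdot oWE oE) /= dot_moebW.
Qed.

(** In the Hardy space picture, 1 / (conj(be) z + conj(al)): the normalised reproducing kernel at
    the zero -be/al of the Moebius map. *)
Definition moeb_eta := moebR (E 0%N).
Local Notation eta := moeb_eta.

(** The adjoint of [moebA] composed with U is [moebB], so the product equals <U y, moebA eta> = <U
    y, E 0>, and E 0 is orthogonal to the range of U. *)
Lemma dot_moebB_eta y : dot (moebB y) eta = 0.
Proof.
rewrite -(dot_shiftU0 y) -(moebAR (E 0%N)) -/eta moebAE moebBE.
rewrite !(dotDl, dotDr, dotZl, dotZr) !conjCK dot_shiftUU addrC; by [].
Qed.

Lemma dot_moebW_eta y : dot (moebW y) eta = 0.
Proof. exact: dot_moebB_eta. Qed.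

Lemma moebWs_eta : moebWs eta = 0.
Proof.
by apply: tE => k; rewrite dotC -moebW_adj dot_moebW_eta rmorph0.
Qed.

Lemma dot_eta_E0 : dot eta (E 0%N) = (Num.conj al)^-1.
Proof.
have ca0 : Num.conj al != 0 by rewrite conjC_eq0.
have := oE 0 0; rewrite -{1}(moebAR (E 0%N)) moebAE dotDl !dotZl dot_shiftU0.
by rewrite mulr0 add0r -/eta => /= e; apply: (mulfI ca0); rewrite e mulfV.
Qed.

(** Pairing [moebA eta] = E 0 and [moebB eta] with eta gives two linear equations in <U eta, eta>
    and <eta, eta>; eliminating the former leaves the determinant, which is 1. *)
Lemma dot_eta : dot eta eta = 1.
Proof.
have e1 : dot (E 0%N) eta = al^-1 by rewrite dotC dot_eta_E0 -fmorphV conjCK.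
move: e1; rewrite -{1}(moebAR (E 0%N)) -/eta moebAE dotDl !dotZl => e1.
have := dot_moebB_eta eta; rewrite moebBE dotDl !dotZl => e2.
have : al * (Num.conj be * dot (U eta) eta + Num.conj al * dot eta eta) = 1.
  by rewrite e1 mulfV.
move: e2 det1'; set u := dot (U eta) eta; set v := dot eta eta.
move=> e2 d e3.
transitivity ((al * Num.conj al - be * Num.conj be) * v); first by rewrite d mul1r.
rewrite -[RHS]e3 -[LHS]addr0 -(mulr0 (Num.conj be)) -e2; ring.
Qed.

Definition moebF k := iter k moebW eta.

Lemma moebF_ortho : ortho dot moebF.
Proof.
have lt k l : dot (moebF (k + l)) (moebF k) = (l == 0)%:R.
  elim: k => [|k IH]; last by rewrite addSn /moebF !iterS dot_moebW.
  by case: l => [|l]; rewrite add0n ?dot_eta // /moebF iterS dot_moebW_eta.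
have ltE k l : dot (moebF (k + l)) (moebF k) = (k + l == k)%N%:R.
  by rewrite lt -[X in _ = (_ == X)%:R]addn0 eqn_add2l.
move=> k l; case: (leqP l k) => [/subnKC <-|/ltnW/subnKC <-]; first exact: ltE.
by rewrite dotC ltE rmorph_nat eq_sym.
Qed.

(** al [moebA] - conj(be) [moebB] = |al|^2 - |be|^2 = 1, because the U terms cancel; composing with
    [moebR] gives the formula. It trades the resolvent for W. *)
Lemma moebR_W x : moebR x = al *: x - Num.conj be *: moebW x.
Proof.
rewrite moebWE -{2}(moebAR x) moebAE; set y := moebR x.
rewrite !scalerDr !scalerA (mulrC _ al) addrAC opprD addrA subrr add0r.
by rewrite (mulrC _ be) addrC -scalerBl det1' scale1r.
Qed.

(* Every vector orthogonal to all [moebF k] is orthogonal to the closed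
   [moebW]-invariant subspace they span; by [moebR_W] the latter contains
   [E 0 = moebA eta] and is invariant under [U]. *)
Lemma moebF_total : total dot moebF.
Proof.
pose X x := forall k, dot x (moebF k) = 0.
(* A double orthogonal complement stands in for the closed span; continuity of the inner product
   makes it closed under limits. *)
pose K y := forall x, X x -> dot x y = 0.
have KW y : K y -> K (moebW y).
  move=> Ky x Xx; rewrite dotC moebW_adj -dotC; apply: Ky => k.
  by rewrite dotC -moebW_adj -dotC -[moebW _]/(moebF k.+1).
have KD y z : K y -> K z -> K (y + z).
  by move=> Ky Kz x Xx; rewrite dotDr Ky // Kz // addr0.
have KZ c y : K y -> K (c *: y) by move=> Ky x Xx; rewrite dotZr Ky // mulr0.
have Klim u y : (forall n, K (u n)) -> cv u y -> K y.
  move=> Ku uy x Xx; apply: (cv_unique (cv_dotr Hdot x uy)).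
  by apply: cv_ext (cv_cst _) => n; rewrite Ku.
have ab : nr (Num.conj be / al) < 1.
  rewrite nrM nrV nr_conj ltr_pdivrMr ?mul1r.
    rewrite -(@ltr_pXn2r _ 2) ?nnegrE ?nr_ge0 //.
    by have := det1; lra.
  rewrite lt_neqAle nr_ge0 andbT eq_sym; apply: contra al0 => /eqP.
  by move=> /nr_eq0 ->.
have [T [[M bT] _ T2 T3]] := neumann moebW_bop ab.
(* By [moebR_W], [moebA] inverts al - conj(be) W, so [moebA y] is a Neumann series in W applied to a
   multiple of [y], and all partial sums stay in [K]. *)
have KA y : K y -> K (moebA y).
  move=> Ky; rewrite -(T2 (moebA y)).
  have -> : moebA y - (Num.conj be / al) *: moebW (moebA y) = al^-1 *: y.
    rewrite -[in RHS](moebRA y) moebR_W scalerBr !scalerA mulVf // scale1r.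
    by rewrite mulrC.
  apply: Klim (T3 _) => n; elim: n => [|n IH].
    by rewrite big_ord0 => x _; rewrite dot0r.
  rewrite big_ord_recr /=; apply: (KD _ _ IH); apply/KZ.
  by elim: n {IH} => [|n IH]; [apply/KZ|rewrite iterS; apply/KW].
have KU y : K y -> K (U y).
  move=> Ky; rewrite (_ : U y = al^-1 *: (moebW (moebA y) + (- be) *: y)).
    by apply/KZ/KD; [apply/KW/KA|apply/KZ].
  by rewrite /moebW /= moebRA moebBE scaleNr addrK scalerA mulVf // scale1r.
have KE k : K (E k).
  elim: k => [|k IH]; last by rewrite -shiftUE; exact: KU.
  by rewrite -(moebAR (E 0%N)); apply: KA => x Xx; exact: (Xx 0%N).
by move=> x Xx; apply: tE => k; apply: KE.
Qed.

End Moebius.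

Lemma moebius_shiftE (g : 'M[R[i]]_2) : SU11 g ->
  moebius_shift E g = moebW (g 0 0) (g 0 1).
Proof. by move=> [g10 g11 _]; rewrite /moebius_shift g10 g11 shiftU_unilateral. Qed.

Lemma SU11_det (g : 'M[R[i]]_2) : SU11 g -> nr (g 0 0) ^+ 2 - nr (g 0 1) ^+ 2 = 1.
Proof.
move=> [_ _ d]; apply: complexI.
by rewrite rmorphB !rmorphXn /= !nrE d.
Qed.

End Shift.

(** * Decay of the coefficients of [W^k x] *)

Section Derivation.
Context (R : realType) (H : completeNormedModType R[i]).
Context (dot : {dot H for Num.conj}) (Hdot : hilbert_norm dot).
Context (E : nat -> H) (HE : orthonormal_basis dot E).
Variables (al be : R[i]).
Hypothesis det1 : nr al ^+ 2 - nr be ^+ 2 = 1.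

Let oE : ortho dot E. Proof. by case: HE. Qed.
Let tE : total dot E. Proof. exact: basis_total HE. Qed.

Local Notation U := (shiftU dot E).
Local Notation A := (moebA dot E al be).
Local Notation Rr := (moebR dot E al be).
Local Notation W := (moebW dot E al be).

Let lU : linear U. Proof. by case: (shiftU_bop Hdot HE). Qed.
Let lR : linear Rr. Proof. exact: moebR_lin. Qed.
Let lW : linear W. Proof. exact: moebW_lin. Qed.

(* [der x y] : [y] is the image of [x] under the unbounded number operator
   [E m |-> m E m], i.e. under [z d/dz] in the Hardy space picture. *)
Definition der x y := forall m, m%:R * dot x (E m) = dot y (E m).

Lemma der_lin z x x' y y' : der x x' -> der y y' -> der (z *: x + y) (z *: x' + y').
Proof. by move=> dx dy m; rewrite !dotDl !dotZl mulrDr mulrCA dx dy. Qed.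

Lemma derU x x' : der x x' -> der (U x) (U (x' + x)).
Proof.
move=> dx [|m]; first by rewrite mul0r dot_shiftU0.
by rewrite !dot_shiftUS // dotDl -dx -natr1 mulrDl mul1r.
Qed.

(* Both sides satisfy the two-term recursion expressed by [A (Rr x) = x]. *)
Lemma derR x x' : der x x' -> der (Rr x) (Rr (x' - Num.conj be *: U (Rr x))).
Proof.
move=> dx m; have ca0 : Num.conj al != 0.
  rewrite conjC_eq0; apply/eqP => a0; have := sqr_ge0 (nr be); have := det1.
  by rewrite a0 nr0 expr0n sub0r => d1; rewrite -oppr_le0 d1 ler10.
have rec y k : Num.conj be * dot (U (Rr y)) (E k) + Num.conj al * dot (Rr y) (E k) =
    dot y (E k).
  by rewrite -{3}(moebAR Hdot HE det1 y) moebAE dotDl !dotZl.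
set y' := _ - _; elim: m => [|m IH].
  rewrite mul0r; apply: (mulfI ca0); rewrite mulr0.
  have := rec y' 0%N; rewrite dot_shiftU0 // mulr0 add0r => ->.
  by rewrite /y' dotBl dotZl dot_shiftU0 // mulr0 subr0 -dx mul0r.
apply: (mulfI ca0).
have := rec y' m.+1; rewrite dot_shiftUS // -IH => e.
have := rec x m.+1; rewrite dot_shiftUS // => e'.
apply: (addrI (Num.conj be * (m%:R * dot (Rr x) (E m)))); rewrite e.
rewrite /y' dotBl dotZl dot_shiftUS // -dx -e' -natr1; ring.
Qed.

(** With determinant 1 the Moebius map has derivative 1 / (conj(be) z + conj(al))^2; the extra
    Leibniz term is therefore R U R x. *)
Lemma derW x x' : der x x' -> der (W x) (W x' + Rr (U (Rr x))).
Proof.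
move=> dx; have dR := derR dx; set r := Rr (x' - _) in dR.
have d0 : der 0 0 by move=> m; rewrite dot0l mulr0.
have := der_lin al (derU dR) (der_lin be dR d0); rewrite !addr0 -moebWE.
congr (der _ _); rewrite (moebR_W Hdot HE det1 (U (Rr x))) (linD _ _ lU) scalerDr.
have -> : al *: U r + al *: U (Rr x) + be *: r =
  (al *: U r + be *: r) + al *: U (Rr x) by rewrite addrAC.
rewrite -moebWE (linB _ _ lW) (linZ _ _ lW).
by rewrite [in RHS]addrA addrAC.
Qed.

Lemma iter_comm (f h : H -> H) k x : (forall y, f (h y) = h (f y)) ->
  f (iter k h x) = iter k h (f x).
Proof. by move=> fh; elim: k => //= k IH; rewrite fh IH. Qed.

(** R U R commutes with W, so the k Leibniz terms coincide. At k = 0 the truncated [k.-1] is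
    harmless, its coefficient being 0. *)
Lemma der_iterW k x x' : der x x' ->
  der (iter k W x) (iter k W x' + k%:R *: iter k.-1 W (Rr (U (Rr x)))).
Proof.
move=> dx; elim: k => [|k IH]; first by rewrite scale0r addr0.
have := derW IH; rewrite !iterS; congr (der _ _).
rewrite (linD _ _ lW) (linZ _ _ lW) -addrA; congr (_ + _).
have -> : Rr (U (Rr (iter k W x))) = iter k W (Rr (U (Rr x))).
  have RW := moebRW Hdot HE det1; have UW := moebUW Hdot HE det1.
  by rewrite (iter_comm _ _ RW) (iter_comm _ _ UW) (iter_comm _ _ RW).
case: k {IH} => [|k]; first by rewrite scale0r add0r scale1r.
by rewrite -[k.+2%:R]natr1 scalerDl scale1r.
Qed.

(** A domain for the unbounded number operator that it maps into itself ([nice_der]), so it can be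
    applied arbitrarily often. It contains the two starting vectors of interest, E 0 and eta = R E
    0. *)
Inductive nice : H -> Prop :=
| nice_vacuum : nice (E 0%N)
| nice_U x : nice x -> nice (U x)
| nice_R x : nice x -> nice (Rr x)
| nice_lin z x y : nice x -> nice y -> nice (z *: x + y).

Lemma nice_der x : nice x -> exists2 x', nice x' & der x x'.
Proof.
have nice0 y : nice y -> nice 0.
  by move=> ny; have := nice_lin (-1) ny ny; rewrite scaleN1r addNr.
elim=> [|{}x nx [x' nx' dx]|{}x nx [x' nx' dx]|z {}x y nx [x' nx' dx] ny [y' ny' dy]].
- exists 0; first exact: nice0 nice_vacuum.
  move=> [|m]; first by rewrite mul0r dot0l.
  by rewrite oE dot0l mulr0.
- exists (U (x' + x)); last exact: derU.
  by apply/nice_U; rewrite -[x']scale1r; apply: nice_lin.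
- exists (Rr (x' - Num.conj be *: U (Rr x))); last exact: derR.
  by apply/nice_R; rewrite addrC -scaleNr; apply: nice_lin => //; apply/nice_U/nice_R.
- by exists (z *: x' + y'); [exact: nice_lin|exact: der_lin].
Qed.

(* Each power of [m + 1] on the left is absorbed by one application of the
   number operator, which costs at most one factor [k] by [der_iterW]. *)
Lemma nice_iterW_decay p x : nice x -> exists2 C : R, 0 <= C & forall k m,
  (1 + m)%:R ^+ p * nr (dot (iter k W x) (E m)) <= C * (1 + k)%:R ^+ p.
Proof.
elim: p x => [|p IH] x nx.
  exists (nr x) => [|k m]; first exact: nr_ge0.
  rewrite !expr0 mul1r mulr1; apply: (le_trans (cauchy_schwarz Hdot _ _)).
  rewrite (ortho_nr Hdot _ oE) mulr1.
  by elim: k => //= k; rewrite (nr_moebW Hdot HE det1).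
have [x' nx' dx] := nice_der nx.
have nxx : nice (x' + x) by rewrite -[x']scale1r; apply: nice_lin.
have [C1 C10 HC1] := IH _ nxx.
have [C2 C20 HC2] := IH _ (nice_R (nice_U (nice_R nx))).
exists (C1 + C2) => [|k m]; first exact: addr_ge0.
set z := Rr (U (Rr x)) in HC2.
have lk : linear (iter k W).
  by case: (bop_iter k (moebW_bop Hdot HE det1)).
have -> : (1 + m)%:R ^+ p.+1 * nr (dot (iter k W x) (E m)) =
  (1 + m)%:R ^+ p * nr (dot (iter k W (x' + x)) (E m) +
                        k%:R * dot (iter k.-1 W z) (E m)).
  rewrite exprSr -mulrA; congr (_ * _).
  rewrite -[X in X * _](nr_nat R) -nrM natrD mulrDl mul1r (der_iterW k dx).
  by rewrite (linD _ _ lk) !dotDl dotZl addrA (addrC (dot (iter k W x) _)).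
apply: (le_trans (ler_wpM2l _ (nrD _ _))); first by rewrite exprn_ge0.
rewrite mulrDr (mulrDl C1) lerD //.
  apply: (le_trans (HC1 k m)); rewrite ler_wpM2l //.
  by rewrite ler_weXn2l // ler1n.
rewrite nrM nr_nat mulrCA.
have : k%:R * ((1 + m)%:R ^+ p * nr (dot (iter k.-1 W z) (E m))) <=
   k%:R * (C2 * (1 + k.-1)%:R ^+ p) :> R by rewrite ler_wpM2l.
move=> /le_trans; apply; rewrite mulrCA ler_wpM2l // exprS.
by rewrite ler_pM // ?exprn_ge0 // ?lerXn2r ?nnegrE // ?ler_nat ?leq_add2l ?leq_pred ?leqnSn.
Qed.

Lemma moebF_decay p : exists2 C : R, 0 <= C & forall k m,
  (1 + m)%:R ^+ p * nr (dot (moebF dot E al be k) (E m)) <= C * (1 + k)%:R ^+ p.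
Proof. exact/nice_iterW_decay/nice_R/nice_vacuum. Qed.

Lemma moebW_vacuum_decay p : exists2 C : R, 0 <= C & forall k m,
  (1 + m)%:R ^+ p * nr (dot (iter k W (E 0%N)) (E m)) <= C * (1 + k)%:R ^+ p.
Proof. exact/nice_iterW_decay/nice_vacuum. Qed.

End Derivation.

(** * The automorphism is unitarily implemented *)

Section Generated.
Context (R : realType) (H : completeNormedModType R[i]).
Context (dot : {dot H for Num.conj}).

(** No condition on [a]: where no adjoint exists, the default value of the choice is the zero
    operator. Hence all bounded operators form a competitor in the intersection defining a generated
    algebra. *)
Lemma adjoint_bounded a : bounded_operator (adjoint dot a).
Proof.
rewrite /adjoint; case: xgetP => [b _ [] //|_]; apply: (@bop_bounded _ _ 0).
split => // [z x y|x]; last by rewrite /cst nr0 mul0r.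
by rewrite /cst scaler0 addr0.
Qed.

Lemma bounded_operator_cstar : cstar_subalgebra dot (@bounded_operator R H).
Proof.
split.
- split => //; apply: (@bop_bounded _ _ 0); split => // [z x y|x].
    by rewrite /cst scaler0 addr0.
  by rewrite /cst nr0 mul0r.
- move=> z a b /bounded_bop[M aM] /bounded_bop[N bN].
  exact: bop_bounded (bop_lin z aM bN).
- move=> a b /bounded_bop[M aM] /bounded_bop[N bN].
  exact: bop_bounded (bop_comp aM bN).
- by move=> a _; exact: adjoint_bounded.
- by [].
Qed.

Lemma cstar_generated_sub G : G `<=` cstar_generated dot G.
Proof. by move=> a Ga B [_ GB]; exact: GB. Qed.

Lemma cstar_generated_cstar G : G `<=` @bounded_operator R H ->
  cstar_subalgebra dot (cstar_generated dot G).
Proof.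
move=> Gb; split.
- split; first by move=> a; apply; split => //; exact: bounded_operator_cstar.
  by move=> B [[[_ B0] _ _ _ _] _].
- move=> z a b Aa Ab B BG; case: (BG) => -[_ Bl _ _ _] _.
  by apply: Bl; [exact: Aa|exact: Ab].
- move=> a b Aa Ab B BG; case: (BG) => -[_ _ Bc _ _] _.
  by apply: Bc; [exact: Aa|exact: Ab].
- move=> a Aa B BG; case: (BG) => -[_ _ _ Bs _] _.
  by apply: Bs; exact: Aa.
- move=> s a As ba sa B BG; case: (BG) => -[_ _ _ _ Bl] _.
  by apply: (Bl s) => // n; exact: As.
Qed.

End Generated.

(** * Membership in the Toeplitz algebra and the action of the automorphism *)

Section Automorphism.
Context (R : realType) (H : completeNormedModType R[i]).
Context (dot : {dot H for Num.conj}) (Hdot : hilbert_norm dot).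
Context (E : nat -> H) (HE : orthonormal_basis dot E).
Variables (al be : R[i]).
Hypothesis det1 : nr al ^+ 2 - nr be ^+ 2 = 1.

Let oE : ortho dot E. Proof. by case: HE. Qed.
Let tE : total dot E. Proof. exact: basis_total HE. Qed.

Local Notation U := (shiftU dot E).
Local Notation Us := (shiftUs dot E).
Local Notation W := (moebW dot E al be).
Local Notation Ws := (moebWs dot E al be).
Local Notation F := (moebF dot E al be).
Local Notation eta := (moeb_eta dot E al be).

Let oF : ortho dot F. Proof. exact: moebF_ortho. Qed.
Let tF : total dot F. Proof. exact: moebF_total. Qed.

Local Notation T := (toeplitz_algebra dot E).

Lemma toeplitz_cstar : cstar_subalgebra dot T.
Proof.
apply: cstar_generated_cstar => _ ->.
by rewrite (shiftU_unilateral Hdot HE); apply: bop_bounded (shiftU_bop Hdot HE).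
Qed.

Lemma toeplitz_bop a : T a -> exists M, bop M a.
Proof. by move=> Ta; apply: bounded_bop; case: toeplitz_cstar => -[+ _] _ _ _ _; apply. Qed.

Lemma toeplitz_cst0 : T (cst 0).
Proof. by case: toeplitz_cstar => -[]. Qed.

Lemma toeplitz_lin z a b : T a -> T b -> T (z *: a + b).
Proof. by case: toeplitz_cstar => _ + _ _ _; apply. Qed.

Lemma toeplitz_comp a b : T a -> T b -> T (a \o b).
Proof. by case: toeplitz_cstar => _ _ + _ _; apply. Qed.

Lemma toeplitz_lim s a : (forall n, T (s n)) -> bounded_operator a -> op_cvg s a -> T a.
Proof. by case: toeplitz_cstar => _ _ _ _; apply. Qed.

Lemma toeplitz_U : T U.
Proof. by rewrite -(shiftU_unilateral Hdot HE); apply: cstar_generated_sub. Qed.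

Lemma toeplitz_Us : T Us.
Proof.
rewrite -(adjoint_shiftU Hdot HE); case: toeplitz_cstar => _ _ _ + _; apply.
exact: toeplitz_U.
Qed.

Lemma toeplitz_add a b : T a -> T b -> T (a + b).
Proof. by move=> Ta Tb; rewrite -[a]scale1r; exact: toeplitz_lin. Qed.

Lemma toeplitz_scale z a : T a -> T (z *: a).
Proof. by move=> Ta; rewrite -[_ *: _]addr0; apply: toeplitz_lin Ta toeplitz_cst0. Qed.

Lemma toeplitz_sum n (u : 'I_n -> H -> H) : (forall k, T (u k)) ->
  T (fun x => \sum_(k < n) u k x).
Proof.
move=> Tu; rewrite (_ : (fun _ => _) = \sum_(k < n) u k); last first.
  by apply/funext => x; rewrite fct_sumE.
elim/big_ind: _ => //; [exact: toeplitz_cst0|exact: toeplitz_add].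
Qed.

Lemma toeplitz_1 : T id.
Proof.
have -> : (id : H -> H) = Us \o U by apply/funext => x /=; rewrite (shiftUsK Hdot HE).
exact: toeplitz_comp toeplitz_Us toeplitz_U.
Qed.

Lemma toeplitz_iter n a : T a -> T (iter n a).
Proof.
move=> Ta; elim: n => [|n IH]; first exact: toeplitz_1.
exact: toeplitz_comp Ta IH.
Qed.

Lemma toeplitz_unit00 : T (matrix_unit dot E 0 0).
Proof.
rewrite (matrix_unit00 Hdot HE).
apply: toeplitz_lin; apply: toeplitz_comp.
all: by [exact: toeplitz_U|exact: toeplitz_Us].
Qed.

(** Factoring through the shift puts every matrix unit in the Toeplitz algebra and makes its image
    under [rho] computable from W alone. *)
Lemma matrix_unitE k l :
  matrix_unit dot E k l = iter k U \o (matrix_unit dot E 0 0 \o iter l Us).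
Proof.
apply/funext => x; rewrite /matrix_unit /=.
have lk : linear (iter k U) by case: (bop_iter k (shiftU_bop Hdot HE)).
rewrite (linZ _ _ lk) (iter_shiftUE Hdot HE) addn0; congr (_ *: _).
elim: l x => // l IH x.
by rewrite iterSr -IH (dot_shiftUs Hdot HE).
Qed.

Lemma toeplitz_unit k l : T (matrix_unit dot E k l).
Proof.
rewrite matrix_unitE; apply: toeplitz_comp; first exact: toeplitz_iter toeplitz_U.
apply: toeplitz_comp; first exact: toeplitz_unit00.
exact: toeplitz_iter toeplitz_Us.
Qed.

Variable rho : (H -> H) -> (H -> H).
Hypothesis Hrho : star_automorphism dot T rho.
Hypothesis HrhoU : rho U = W.

Let rho_lin z a b : T a -> T b -> rho (z *: a + b) = z *: rho a + rho b.
Proof. by case: Hrho => _ + _ _; apply. Qed.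

Let rho_comp a b : T a -> T b -> rho (a \o b) = rho a \o rho b.
Proof. by case: Hrho => _ _ + _; apply. Qed.

Let rho_mem a : T a -> T (rho a).
Proof. by case: Hrho => -[+ _ _] _ _ _; apply. Qed.

Let rho_Us : rho Us = Ws.
Proof.
rewrite -(adjoint_shiftU Hdot HE); case: Hrho => _ _ _ ->; last exact: toeplitz_U.
by rewrite HrhoU (adjoint_moebW Hdot HE det1).
Qed.

Let rho_0 : rho (cst 0) = 0.
Proof.
have := rho_lin (-1) toeplitz_cst0 toeplitz_cst0.
by rewrite !scaleN1r !addNr => e; exact: e.
Qed.

Let rho_scale z a : T a -> rho (z *: a) = z *: rho a.
Proof.
move=> Ta; rewrite -[z *: a]addr0 (rho_lin z Ta toeplitz_cst0).
by rewrite rho_0 addr0.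
Qed.

Lemma rho_add a b : T a -> T b -> rho (a + b) = rho a + rho b.
Proof. by move=> Ta Tb; rewrite -{1}[a]scale1r rho_lin // scale1r. Qed.

Let rho_1 : rho id = id.
Proof.
have -> : (id : H -> H) = Us \o U by apply/funext => x /=; rewrite (shiftUsK Hdot HE).
rewrite rho_comp ?HrhoU ?rho_Us; [|exact: toeplitz_Us|exact: toeplitz_U].
by apply/funext => x /=; rewrite (moebWsK Hdot HE det1) (shiftUsK Hdot HE).
Qed.

Let rho_iter n a : T a -> rho (iter n a) = iter n (rho a).
Proof.
move=> Ta; elim: n => [|n IH]; first exact: rho_1.
rewrite (_ : iter n.+1 a = a \o iter n a); last by [].
by rewrite rho_comp ?IH //; exact: toeplitz_iter.
Qed.

Let rho_unit00 x : rho (matrix_unit dot E 0 0) x = x - W (Ws x).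
Proof.
have TU := toeplitz_U; have TUs := toeplitz_Us.
rewrite (matrix_unit00 Hdot HE) rho_lin; try exact: toeplitz_comp.
rewrite !rho_comp // HrhoU rho_Us !fctE /= (moebWsK Hdot HE det1).
by rewrite scaleN1r addrC.
Qed.

Let rho_unit k l x : rho (matrix_unit dot E k l) x =
  iter k W (iter l Ws x - W (Ws (iter l Ws x))).
Proof.
have TU := toeplitz_U; have TUs := toeplitz_Us; have T00 := toeplitz_unit00.
have Tk := toeplitz_iter k TU; have Tl := toeplitz_iter l TUs.
rewrite (matrix_unitE k l) (rho_comp Tk (toeplitz_comp T00 Tl)) (rho_comp T00 Tl).
by rewrite (rho_iter k TU) (rho_iter l TUs) HrhoU rho_Us /= rho_unit00.
Qed.

(* Compressing [a] by rank-one matrix units, which [rho] maps to the rank-one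
   operators built from [F], is a purely algebraic way to read off matrix
   coefficients. *)
Lemma rho_coef a k l : T a -> dot (rho a (F k)) (F l) = dot (a (E k)) (E l).
Proof.
move=> Ta; have [M [la _ _]] := toeplitz_bop Ta.
have compE : matrix_unit dot E 0 l \o (a \o matrix_unit dot E k 0) =
    dot (a (E k)) (E l) *: matrix_unit dot E 0 0.
  apply/funext => x; rewrite /matrix_unit !fctE /= (linZ _ _ la) dotZl scalerA.
  by rewrite mulrC.
have Tu := toeplitz_unit.
(* [rho] sends P_{0,0} to 1 - W W^*, which fixes eta. Evaluated factor by factor, the same
   expression sends eta to F k by the image of P_{k,0}, and the image of P_{0,l} followed by pairing
   with eta is pairing with F l. *)
have e : dot (rho (matrix_unit dot E 0 l \o (a \o matrix_unit dot E k 0)) eta) eta =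
         dot (a (E k)) (E l) * dot eta eta.
  rewrite compE rho_scale // fctE rho_unit00 (moebWs_eta Hdot HE det1).
  by rewrite (lin0 (moebW_lin Hdot HE det1)) subr0 dotZl.
move: e; rewrite (dot_eta Hdot HE det1) mulr1 => <-.
rewrite (rho_comp (Tu 0%N l) (toeplitz_comp Ta (Tu k 0%N))) (rho_comp Ta (Tu k 0%N)).
rewrite /= !rho_unit /= (moebWs_eta Hdot HE det1) (lin0 (moebW_lin Hdot HE det1)) subr0.
rewrite dotBl (dot_moebW_eta Hdot HE det1) subr0 /moebF.
elim: l (rho a _) {compE} => //= l IH y.
by rewrite -[Ws (iter l Ws y)]iterS iterSr -IH [RHS]dotC -(moebW_adj Hdot HE det1) -dotC.
Qed.

Definition moebV := omap dot E F.
Definition moebVs := omap dot F E.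

Lemma moebV_bop : bop 1 moebV. Proof. exact: omap_bop. Qed.
Lemma moebVs_bop : bop 1 moebVs. Proof. exact: omap_bop. Qed.

(** [rho a] is bounded because it lies in the Toeplitz algebra, so equality of all coefficients in
    the total family [F] determines it. *)
Lemma rhoE a : T a -> rho a = moebV \o (a \o moebVs).
Proof.
move=> Ta; have [M bM] := toeplitz_bop Ta; have [N bN] := toeplitz_bop (rho_mem Ta).
apply: (bop_ext Hdot oF tF bN (bop_comp moebV_bop (bop_comp bM moebVs_bop))) => k.
apply: (total_ext tF) => l; rewrite rho_coef // /= (dot_omap Hdot oE oF).
by rewrite /moebVs (omapE Hdot oF oE).
Qed.

Lemma rho_op_cvg s a : (forall n, T (s n)) -> T a -> op_cvg s a ->
  op_cvg (fun n => rho (s n)) (rho a).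
Proof.
move=> Ts Ta /op_cvgP sa; apply/op_cvgP => e e0.
have [N HN] := sa _ e0; exists N => n Nn x.
have [lV _ VM] := moebV_bop; have [_ _ VsM] := moebVs_bop.
rewrite !rhoE //= -(linB _ _ lV); apply: (le_trans (VM _)); rewrite mul1r.
apply: (le_trans (HN _ Nn _)); rewrite ler_wpM2l ?(ltW e0) //.
by have := VsM x; rewrite mul1r.
Qed.

Lemma rho_iterU n : rho (iter n U) = iter n W.
Proof. by rewrite rho_iter ?HrhoU //; exact: toeplitz_U. Qed.

Lemma rho_iterUs n : rho (iter n Us) = iter n Ws.
Proof. by rewrite rho_iter ?rho_Us //; exact: toeplitz_Us. Qed.

Lemma rho_unitE k l x : rho (matrix_unit dot E k l) x = dot x (F l) *: F k.
Proof.
rewrite rhoE /=; last exact: toeplitz_unit.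
have [lV _ _] := moebV_bop.
by rewrite /matrix_unit (linZ _ _ lV) /moebV /moebVs (omapE Hdot oE oF) (dot_omap Hdot oF oE).
Qed.

End Automorphism.

(** * Toeplitz operators *)

Section Summation.
Context (R : realType).

Lemma inv_square_sum (N : nat) : \sum_(n < N) ((1 + n)%:R ^+ 2)^-1 <= 2 :> R.
Proof.
(* The sharper bound makes the induction close, by 1/(x+1)^2 <= 1/x - 1/(x+1). *)
suff : \sum_(n < N.+1) ((1 + n)%:R ^+ 2)^-1 <= 2 - (N.+1%:R)^-1 :> R.
  move=> h; apply: le_trans (le_trans h _); last by rewrite gerBl invr_ge0.
  by rewrite big_ord_recr lerDl invr_ge0 exprn_ge0.
elim: N => [|N IH]; first by rewrite big_ord1 addn0 expr1n invr1; lra.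
rewrite big_ord_recr /=; apply: (le_trans (lerD IH (lexx _))).
have N1 : 0 < N.+1%:R :> R by rewrite ltr0n.
rewrite add1n -[N.+2%:R]natr1; move: (N.+1%:R : R) N1 => x x0.
have : ((x + 1) ^+ 2)^-1 <= x^-1 - (x + 1)^-1.
  rewrite -subr_ge0.
  have -> : x^-1 - (x + 1)^-1 - ((x + 1) ^+ 2)^-1 = (x * (x + 1) ^+ 2)^-1.
    by field; apply/andP; split; apply: lt0r_neq0; lra.
  by rewrite invr_ge0 mulr_ge0 ?exprn_ge0 ?addr_ge0 ?ltW.
lra.
Qed.

(** Two spare powers of 1 + n leave a multiple of the inverse squares, whose sum is at most 2; the
    factor 2 in later constants comes from here. *)
Lemma decay_sum (b : nat -> R) p C : (forall n, 0 <= b n) ->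
  (forall n, (1 + n)%:R ^+ (p + 2) * b n <= C) ->
  forall N, \sum_(n < N) (1 + n)%:R ^+ p * b n <= C * 2.
Proof.
move=> b0 bC N.
have C0 : 0 <= C by apply: le_trans (bC 0%N); rewrite mulr_ge0 ?exprn_ge0.
apply: (@le_trans _ _ (\sum_(n < N) C * ((1 + n)%:R ^+ 2)^-1)).
  apply: ler_sum => n _; have n1 : 0 < (1 + n)%:R ^+ 2 :> R by rewrite exprn_gt0.
  by rewrite ler_pdivlMr // mulrAC -exprD.
by rewrite -mulr_sumr ler_wpM2l // inv_square_sum.
Qed.

(** Frequencies n and -n are weighed together to index by [nat]; [f 0] counts twice, which only
    enlarges the bound. *)
Definition rdecay (f : int -> R[i]) := forall p, exists C : R, forall n : nat,
  (1 + n)%:R ^+ p * (nr (f n%:Z) + nr (f (- n%:Z))) <= C.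

(** The value 0 at index 0 lets both halves of a two-sided sum run over [n < N] without repeating
    the constant term. *)
Definition negcoef (f : int -> R[i]) (n : nat) : R[i] :=
  if n is n'.+1 then f (- (n'.+1)%:Z) else 0.

Lemma nr_negcoef f n : nr (negcoef f n) <= nr (f (- n%:Z)).
Proof. by case: n => //; rewrite nr0 nr_ge0. Qed.

Lemma sum1_negcoef (V : lmodType R[i]) (f : int -> R[i]) (u : nat -> V) N :
  \sum_(1 <= n < N) f (- n%:Z) *: u n = \sum_(n < N) negcoef f n *: u n.
Proof.
case: N => [|N]; first by rewrite big_geq // big_ord0.
rewrite big_add1 /= big_ord_recl /= scale0r add0r big_mkord.
by apply: eq_bigr.
Qed.

End Summation.

Section TwoSided.
Context (R : realType) (H : completeNormedModType R[i]).

(** Kept general in [X] and [Y]: the pair U, U^* gives the partial sums of T(f), and W, W^* those of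
    its image under [rho]. *)
Definition tsum (f : int -> R[i]) (X Y : H -> H) (N : nat) (x : H) : H :=
  \sum_(n < N) (f n%:Z *: iter n X x + negcoef f n *: iter n Y x).

Lemma tsum_cvg f X Y : rdecay f -> bop 1 X -> bop 1 Y ->
  exists t, bounded_operator t /\ op_cvg (tsum f X Y) t.
Proof.
move=> df bX bY; have [C HC] := df 2.
pose b n := nr (f n%:Z) + nr (negcoef f n).
have b0 n : 0 <= b n by rewrite addr_ge0 ?nr_ge0.
have bC n : (1 + n)%:R ^+ (0 + 2) * b n <= C.
  apply: le_trans (HC n); rewrite ler_wpM2l ?exprn_ge0 // lerD2l; exact: nr_negcoef.
have [||t [bt tN]] := @op_series _ H (fun n => f n%:Z *: iter n X + negcoef f n *: iter n Y) b (C * 2).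
- move=> n; have [lX _ MX] := bop_iter n bX; have [lY _ MY] := bop_iter n bY.
  split => [z x y||x]; last 2 first.
  + exact: b0.
  + rewrite !fctE mulrDl; apply: (le_trans (nrD _ _)); rewrite !nrZ.
    have := MX x; have := MY x; rewrite !mul1r => ? ?.
    by rewrite lerD // ler_wpM2l ?nr_ge0.
  + rewrite !fctE lX lY !scalerDr !scalerA !(mulrC z).
    by rewrite addrACA.
- move=> N; apply: le_trans (decay_sum b0 bC N).
  by apply: ler_sum => n _; rewrite expr0 mul1r.
by exists t; split; [exact: bop_bounded bt|exact: tN].
Qed.

Context (dot : {dot H for Num.conj}) (Hdot : hilbert_norm dot).
Context (E : nat -> H) (HE : orthonormal_basis dot E).

Let oE : ortho dot E. Proof. by case: HE. Qed.
Let tE : total dot E. Proof. exact: basis_total HE. Qed.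

Local Notation U := (shiftU dot E).
Local Notation Us := (shiftUs dot E).

Lemma toeplitz_partialE f : toeplitz_partial dot E f = tsum (fourier_coef f) U Us.
Proof.
apply/funext => N; apply/funext => x; rewrite /toeplitz_partial /tsum.
rewrite (shiftU_unilateral Hdot HE) (adjoint_shiftU Hdot HE) big_split /=.
by rewrite (sum1_negcoef _ (fun n => iter n Us x)).
Qed.

Lemma dot_tsum f X Y N x y : dot (tsum f X Y N x) y =
  \sum_(n < N) (f n%:Z * dot (iter n X x) y + negcoef f n * dot (iter n Y x) y).
Proof.
by rewrite dot_suml; apply: eq_bigr => n _; rewrite dotDl !dotZl.
Qed.

Lemma iter_adj (X Y : H -> H) n x y : (forall x y, dot (X x) y = dot x (Y y)) ->
  dot (iter n X x) y = dot x (iter n Y y).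
Proof. by move=> XY; elim: n x => // n IH x; rewrite iterSr IH XY. Qed.

(** The Brown-Halmos identity U^* t U = t in weak form: the matrix of [t] is constant along
    diagonals. *)
Definition toep (t : H -> H) := forall x y, dot (t (U x)) (U y) = dot (t x) y.

(** Moving [Y] to the other argument as [X], both halves reduce to commuting [X] past the isometry
    U. With X = W this is why no compact correction appears. *)
Lemma tsum_toep f X Y t : (forall x, U (X x) = X (U x)) ->
  (forall x y, dot (X x) y = dot x (Y y)) -> op_cvg (tsum f X Y) t -> toep t.
Proof.
move=> UX XY ft x y.
apply: (cv_unique (cv_dotl Hdot (U y) (op_cvg_cv (U x) ft))).
apply: cv_ext (cv_dotl Hdot y (op_cvg_cv x ft)) => N.
rewrite !dot_tsum; apply: eq_bigr => n _.
have YX u v : dot (Y u) v = dot u (X v) by rewrite dotC -XY -dotC.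
have UXn u : iter n X (U u) = U (iter n X u) by rewrite -iter_comm.
congr (_ * _ + _ * _); first by rewrite UXn (dot_shiftUU Hdot HE).
by rewrite !(iter_adj _ _ _ YX) UXn (dot_shiftUU Hdot HE).
Qed.

(** Every matrix entry slides up its diagonal until it meets the zeroth row or column. *)
Lemma toep_ext t t' M M' : bop M t -> bop M' t' -> toep t -> toep t' ->
  (forall m, dot (t (E 0%N)) (E m) = dot (t' (E 0%N)) (E m)) ->
  (forall m, dot (t (E m.+1)) (E 0%N) = dot (t' (E m.+1)) (E 0%N)) -> t = t'.
Proof.
move=> bt bt' Tt Tt' c r; apply: (bop_ext Hdot oE tE bt bt') => j.
apply: (total_ext tE); elim: j => [|j IH] [|i] //.
by rewrite -!(shiftUE Hdot HE) Tt Tt' IH.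
Qed.

Lemma iter_shiftUs0 n : iter n.+1 Us (E 0%N) = 0.
Proof.
have [lUs _ _] := shiftUs_bop Hdot HE.
by elim: n => [|n IH]; rewrite iterS ?IH ?(lin0 lUs) //= (shiftUs0 Hdot HE).
Qed.

Lemma tsum_col f t m : op_cvg (tsum f U Us) t -> dot (t (E 0%N)) (E m) = f m%:Z.
Proof.
move=> ft; apply: (cv_unique (cv_dotl Hdot (E m) (op_cvg_cv (E 0%N) ft))).
apply: cv_near_eq (cv_cst _); exists m.+1 => // N mN; rewrite dot_tsum.
rewrite (bigD1 (Ordinal mN)) //= big1 => [|i].
  rewrite (iter_shiftUE Hdot HE) oE addn0 eqxx mulr1 addr0.
  by case: (m) => [|k]; rewrite ?mul0r ?addr0 // iter_shiftUs0 dot0l mulr0 addr0.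
rewrite -val_eqE /= => im.
rewrite (iter_shiftUE Hdot HE) oE addn0 (negbTE im) mulr0 add0r.
by case: (val i) => [|k]; rewrite ?mul0r // iter_shiftUs0 dot0l mulr0.
Qed.

Lemma tsum_row f t m : op_cvg (tsum f U Us) t ->
  dot (t (E m.+1)) (E 0%N) = f (- (m.+1)%:Z).
Proof.
move=> ft; apply: (cv_unique (cv_dotl Hdot (E 0%N) (op_cvg_cv (E m.+1) ft))).
have UsU x y : dot (Us x) y = dot x (U y) by rewrite dotC -(shiftU_adj Hdot HE) -dotC.
apply: cv_near_eq (cv_cst _); exists m.+2 => // N mN; rewrite dot_tsum.
rewrite (bigD1 (Ordinal mN)) //= big1 => [|i].
  by rewrite -!iterS (iter_adj _ _ _ UsU) !(iter_shiftUE Hdot HE) !oE addn0 eqxx addnS mulr0 add0r mulr1 addr0.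
rewrite -val_eqE /= => im.
by rewrite (iter_adj _ _ _ UsU) !(iter_shiftUE Hdot HE) !oE addn0 addnS (eq_sym m.+1) (negbTE im) !mulr0 addr0.
Qed.

Variables (al be : R[i]).
Hypothesis det1 : nr al ^+ 2 - nr be ^+ 2 = 1.
Local Notation W := (moebW dot E al be).
Local Notation Ws := (moebWs dot E al be).

Let WsW x y : dot (Ws x) y = dot x (W y).
Proof. by rewrite dotC -(moebW_adj Hdot HE det1) -dotC. Qed.

(* [W] commutes with the shift, hence is lower triangular in the basis [E]. *)
Lemma dot_iterW_upper n m : nr (dot (iter n W (E m)) (E 0%N)) <= (m == 0%N)%:R.
Proof.
case: m => [|m].
  apply: (le_trans (cauchy_schwarz Hdot _ _)); rewrite (ortho_nr Hdot _ oE) mulr1.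
  have [_ _ M] := bop_iter n (moebW_bop Hdot HE det1).
  by apply: (le_trans (M _)); rewrite (ortho_nr Hdot _ oE) mulr1.
rewrite -(shiftUE Hdot HE) -iter_comm; last exact: moebUW.
by rewrite (dot_shiftU0 Hdot HE) nr0.
Qed.

Lemma tsum_moeb_decay f t : rdecay f -> op_cvg (tsum f W Ws) t ->
  forall p, exists C : R, forall m,
    (1 + m)%:R ^+ p * nr (dot (t (E 0%N)) (E m)) <= C /\
    (1 + m)%:R ^+ p * nr (dot (t (E m)) (E 0%N)) <= C.
Proof.
move=> df ft p.
have [C C0 HC] := moebW_vacuum_decay Hdot HE det1 p.
have [K HK] := df (p + 2)%N.
pose b n := nr (f n%:Z) + nr (f (- n%:Z)).
have b0 n : 0 <= b n by rewrite addr_ge0 ?nr_ge0.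
have pow m : 0 <= (1 + m)%:R ^+ p :> R by rewrite exprn_ge0.
have one m : (1 + m)%:R ^+ p * (m == 0%N)%:R <= 1 :> R.
  by case: m => [|m]; rewrite ?mulr0 // addn0 expr1n mulr1.
have bound (v : nat -> R[i]) (l : R[i]) m :
    cv v l -> (forall N, nr (v N) <= \sum_(n < N) b n *
      (nr (dot (iter n W (E 0%N)) (E m)) + (m == 0%N)%:R)) ->
    (1 + m)%:R ^+ p * nr l <= (C + 1) * (K * 2).
  move=> vl vb.
  rewrite -[X in X ^+ p](nr_nat R) -nrX -nrM.
  apply: (cv_nr_le _ (cvM' ((1 + m)%:R ^+ p : R[i]) vl)) => N.
  rewrite nrM nrX nr_nat; apply: (le_trans (ler_wpM2l (pow m) (vb N))).
  apply: (@le_trans _ _ ((C + 1) * \sum_(n < N) (1 + n)%:R ^+ p * b n)); last first.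
    rewrite ler_wpM2l ?addr_ge0 //; exact: decay_sum.
  rewrite !mulr_sumr; apply: ler_sum => n _.
  rewrite mulrCA [leRHS]mulrA [leRHS]mulrC ler_wpM2l // mulrDr mulrDl mul1r lerD //.
  by apply: (le_trans (one m)); rewrite -[leLHS](expr1n _ p) lerXn2r ?nnegrE // ler1n.
(* [C] bounds the entries of W^n E 0, and 1 covers the other half of the series, which contributes
   only at m = 0 by triangularity; [K * 2] is the weighted sum of the coefficients. Passing from
   column to row swaps the halves. *)
exists ((C + 1) * (K * 2)) => m; split.
  apply: bound (cv_dotl Hdot (E m) (op_cvg_cv (E 0%N) ft)) _ => N.
  rewrite dot_tsum; apply: (le_trans (nr_sum _ _ _)); apply: ler_sum => n _.
  apply: (le_trans (nrD _ _)); rewrite !nrM (iter_adj _ _ _ WsW) (dotC _ (E 0%N)) nr_conj.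
  rewrite mulrDr lerD //.
    by rewrite ler_wpM2r ?nr_ge0 // lerDl nr_ge0.
  rewrite ler_pM ?nr_ge0 //; last exact: dot_iterW_upper.
  by apply: (le_trans (nr_negcoef _ _)); rewrite lerDr nr_ge0.
apply: bound (cv_dotl Hdot (E 0%N) (op_cvg_cv (E m) ft)) _ => N.
rewrite dot_tsum; apply: (le_trans (nr_sum _ _ _)); apply: ler_sum => n _.
apply: (le_trans (nrD _ _)); rewrite !nrM (iter_adj _ _ _ WsW) (dotC _ (E m)) nr_conj.
rewrite mulrDr [leRHS]addrC lerD //.
  by rewrite ler_pM ?nr_ge0 ?lerDl ?nr_ge0 //; exact: dot_iterW_upper.
rewrite ler_wpM2r ?nr_ge0 //.
by apply: (le_trans (nr_negcoef _ _)); rewrite lerDr nr_ge0.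
Qed.

Variable rho : (H -> H) -> (H -> H).
Hypothesis Hrho : star_automorphism dot (toeplitz_algebra dot E) rho.
Hypothesis HrhoU : rho U = W.

Lemma tsum_toeplitz f N : toeplitz_algebra dot E (tsum f U Us N).
Proof.
apply: (toeplitz_sum Hdot HE (u := fun n => f n%:Z *: iter n U + negcoef f n *: iter n Us)) => n.
have TU := toeplitz_iter Hdot HE n (toeplitz_U Hdot HE).
have TUs := toeplitz_iter Hdot HE n (toeplitz_Us Hdot HE).
exact: (toeplitz_lin Hdot HE _ TU (toeplitz_scale Hdot HE _ TUs)).
Qed.

Lemma tsum_toeplitz_lim f t : bounded_operator t -> op_cvg (tsum f U Us) t ->
  toeplitz_algebra dot E t.
Proof.
by move=> bt ft; apply: (toeplitz_lim Hdot HE _ bt ft) => N; exact: tsum_toeplitz.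
Qed.

Lemma rho_tsum f N : rho (tsum f U Us N) = tsum f W Ws N.
Proof.
rewrite (rhoE Hdot HE det1 Hrho HrhoU (tsum_toeplitz f N)); apply/funext => x /=.
have [lV _ _] := moebV_bop Hdot HE det1.
have TU n := toeplitz_iter Hdot HE n (toeplitz_U Hdot HE).
have TUs n := toeplitz_iter Hdot HE n (toeplitz_Us Hdot HE).
rewrite (lin_sum _ lV); apply: eq_bigr => n _.
rewrite (linD _ _ lV) !(linZ _ _ lV); congr (_ *: _ + _ *: _).
  by rewrite -(rho_iterU Hdot HE det1 Hrho HrhoU n) (rhoE Hdot HE det1 Hrho HrhoU (TU n)).
by rewrite -(rho_iterUs Hdot HE det1 Hrho HrhoU n) (rhoE Hdot HE det1 Hrho HrhoU (TUs n)).
Qed.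

Lemma rho_toeplitz f t : rdecay f -> bounded_operator t -> op_cvg (tsum f U Us) t ->
  exists2 g, rdecay g & op_cvg (tsum g U Us) (rho t).
Proof.
move=> df bt ft; have Tt := tsum_toeplitz_lim bt ft.
have Wt : op_cvg (tsum f W Ws) (rho t).
  have := rho_op_cvg Hdot HE det1 Hrho HrhoU (tsum_toeplitz f) Tt ft.
  by under eq_fun do rewrite rho_tsum.
(* The zeroth column gives the nonnegative frequencies and the zeroth row the negative ones;
   [Negz m] is -(m + 1), hence the index [m.+1]. *)
pose g (z : int) := match z with
  | Posz m => dot (rho t (E 0%N)) (E m)
  | Negz m => dot (rho t (E m.+1)) (E 0%N) end.
have dg : rdecay g.
  move=> p; have [C HC] := tsum_moeb_decay df Wt p.
  exists (C + C) => m; rewrite mulrDr; have [Cc Cr] := HC m.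
  by apply: lerD => //; case: m Cc Cr => [|m] Cc Cr.
exists g => //.
have [t' [bt' gt']] := tsum_cvg dg (shiftU_bop Hdot HE) (shiftUs_bop Hdot HE).
have [M bM] : exists M, bop M (rho t).
  by apply: (toeplitz_bop Hdot HE); case: Hrho => -[+ _ _] _ _ _; apply.
have [M' bM'] := bounded_bop bt'.
rewrite (_ : rho t = t') //; apply: (toep_ext bM bM').
- by apply: (tsum_toep _ _ Wt); [exact: moebUW|exact: moebW_adj].
- by apply: (tsum_toep _ _ gt') => //; exact: shiftU_adj.
- by move=> m; rewrite (tsum_col m gt').
- by move=> m; rewrite (tsum_row m gt').
Qed.

End TwoSided.

(** * Smooth compact operators *)

Section RapidDecay.
Context (R : realType).
Implicit Types c : nat -> nat -> R[i].

Lemma rapid_decayP c : rapid_decay c <-> forall M N : nat, exists C : R, forall k l,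
  (1 + k)%:R ^+ M * (1 + l)%:R ^+ N * nr (c k l) <= C.
Proof.
have e M N k l : (1 + k)%:R ^+ M * (1 + l)%:R ^+ N * `|c k l| =
    ((1 + k)%:R ^+ M * (1 + l)%:R ^+ N * nr (c k l))%:C.
  by rewrite !rmorphM !rmorphXn /= !rmorph_nat nrE.
split=> dc M N; have [C HC] := dc M N.
  exists (complex.Re C) => k l; have := HC k l.
  by rewrite e lecE => /andP[_].
by exists C%:C => k l; rewrite e lecR.
Qed.

Lemma rapid_decay_sum c M N : rapid_decay c -> exists2 C : R, 0 <= C & forall n,
  \sum_(k < n) \sum_(l < n) (1 + k)%:R ^+ M * (1 + l)%:R ^+ N * nr (c k l) <= C.
Proof.
move=> /rapid_decayP /(_ (M + 2)%N (N + 2)%N)[C HC].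
have C0 : 0 <= C.
  by apply: le_trans (HC 0%N 0%N); rewrite !mulr_ge0 ?exprn_ge0 ?nr_ge0.
exists (C * 2 * 2) => [|n]; first by rewrite !mulr_ge0.
have step k : (1 + k)%:R ^+ (M + 2) *
    \sum_(l < n) (1 + l)%:R ^+ N * nr (c k l) <= C * 2.
  rewrite mulr_sumr.
  under eq_bigr do rewrite mulrCA.
  apply: (@decay_sum R (fun l => (1 + k)%:R ^+ (M + 2) * nr (c k l))) => l.
    by rewrite mulr_ge0 ?exprn_ge0 ?nr_ge0.
  by rewrite mulrCA mulrA; exact: HC.
apply: le_trans (@decay_sum R (fun k => \sum_(l < n) (1 + l)%:R ^+ N * nr (c k l)) M (C * 2) _ step n).
  apply: ler_sum => k _; rewrite mulr_sumr; apply: ler_sum => l _.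
  by rewrite mulrA.
by move=> k; apply: sumr_ge0 => l _; rewrite mulr_ge0 ?exprn_ge0 ?nr_ge0.
Qed.

End RapidDecay.

Section Compact.
Context (R : realType) (H : completeNormedModType R[i]).
Context (dot : {dot H for Num.conj}) (Hdot : hilbert_norm dot).
Context (E : nat -> H) (HE : orthonormal_basis dot E).

Let oE : ortho dot E. Proof. by case: HE. Qed.
Let tE : total dot E. Proof. exact: basis_total HE. Qed.

Local Notation P := (matrix_unit dot E).

Definition msum (c : nat -> nat -> R[i]) (N : nat) (x : H) : H :=
  \sum_(k < N) \sum_(l < N) c k l *: P k l x.

Lemma matrix_unit_bop k l : bop 1 (P k l).
Proof.
split => // [z x y|x]; first by rewrite /matrix_unit dotDl dotZl scalerDl scalerA.
rewrite nrZ (ortho_nr Hdot _ oE) mulr1 mul1r.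
by apply: (le_trans (cauchy_schwarz Hdot _ _)); rewrite (ortho_nr Hdot _ oE) mulr1.
Qed.

Let P_le k l x : nr (P k l x) <= nr x.
Proof. by have [_ _ /(_ x)] := matrix_unit_bop k l; rewrite mul1r. Qed.

Lemma msumS c N x : msum c N.+1 x - msum c N x =
  \sum_(k < N) c k N *: P k N x + \sum_(l < N.+1) c N l *: P N l x.
Proof.
rewrite /msum big_ord_recr /=.
under eq_bigr do rewrite big_ord_recr /=.
by rewrite big_split /= -[X in X - _]addrA addrAC subrr add0r.
Qed.

(** Growing the square of indices adds an L-shaped border, one column and one row. The border bounds
    add up to the full double sum, so the test for operator series applies. *)
Lemma msum_cvg c : rapid_decay c -> exists a, bounded_operator a /\ op_cvg (msum c) a.
Proof.
move=> dc; have [C C0 HC] := rapid_decay_sum 0 0 dc.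
pose b N := \sum_(k < N) nr (c k N) + \sum_(l < N.+1) nr (c N l).
have bE N : \sum_(n < N) b n = \sum_(k < N) \sum_(l < N) nr (c k l).
  elim: N => [|N IH]; first by rewrite !big_ord0.
  rewrite big_ord_recr /= IH [RHS]big_ord_recr /=.
  under [in RHS]eq_bigr do rewrite big_ord_recr /=.
  by rewrite [in RHS]big_split /= addrA.
have bC N : \sum_(n < N) b n <= C.
  rewrite bE; apply: le_trans (HC N); apply: ler_sum => k _; apply: ler_sum => l _.
  by rewrite !expr0 !mul1r.
have lin N : linear (msum c N).
  move=> z x y; rewrite /msum scaler_sumr -big_split /=; apply: eq_bigr => k _.
  rewrite scaler_sumr -big_split /=; apply: eq_bigr => l _.
  by have [-> _ _] := matrix_unit_bop k l; rewrite scalerDr !scalerA (mulrC z).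
have [|a [ba ca]] := @op_series _ H (fun n x => msum c n.+1 x - msum c n x) b C _ bC.
  move=> n; split => [z x y||x].
  - by rewrite !lin scalerBr opprD addrACA.
  - by rewrite addr_ge0 // sumr_ge0 // => i _; rewrite nr_ge0.
  - rewrite msumS mulrDl !mulr_suml; apply: (le_trans (nrD _ _)).
    rewrite lerD //; apply: (le_trans (nr_sum _ _ _)); apply: ler_sum => i _;
      by rewrite nrZ ler_wpM2l ?nr_ge0.
exists a; split; first exact: bop_bounded ba.
have e : (fun N x => \sum_(n < N) (msum c n.+1 x - msum c n x)) = msum c.
  apply/funext => N; apply/funext => x; elim: N => [|N IH].
    by rewrite /msum !big_ord0.
  by rewrite big_ord_recr /= IH addrC subrK.
by rewrite -e.
Qed.

Lemma msum_coef c a i j : op_cvg (msum c) a -> dot (a (E j)) (E i) = c i j.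
Proof.
move=> ca; apply: (cv_unique (cv_dotl Hdot (E i) (op_cvg_cv (E j) ca))).
apply: cv_near_eq (cv_cst _); exists (maxn i j).+1 => // N /= ijN.
have iN : (i < N)%N by apply: leq_ltn_trans ijN; exact: leq_maxl.
have jN : (j < N)%N by apply: leq_ltn_trans ijN; exact: leq_maxr.
rewrite dot_suml (bigD1 (Ordinal iN)) //= dot_suml (bigD1 (Ordinal jN)) //=.
rewrite /matrix_unit !dotZl !oE !eqxx !mulr1 !big1 ?addr0 //.
- move=> k; rewrite -val_eqE /= => /negbTE ki.
  by rewrite dot_suml big1 // => l _; rewrite !dotZl !oE ki !mulr0.
- move=> l; rewrite -val_eqE /= eq_sym => /negbTE jl.
  by rewrite !dotZl !oE jl mul0r mulr0.
Qed.

Variables (al be : R[i]).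
Hypothesis det1 : nr al ^+ 2 - nr be ^+ 2 = 1.
Local Notation F := (moebF dot E al be).
Variable rho : (H -> H) -> (H -> H).
Hypothesis Hrho : star_automorphism dot (toeplitz_algebra dot E) rho.
Hypothesis HrhoU : rho (shiftU dot E) = moebW dot E al be.

Lemma msum_toeplitz c N : toeplitz_algebra dot E (msum c N).
Proof.
apply: (toeplitz_sum Hdot HE (u := fun k x => \sum_(l < N) c k l *: P k l x)) => k.
apply: (toeplitz_sum Hdot HE (u := fun l => c k l *: P k l)) => l.
exact: (toeplitz_scale Hdot HE _ (toeplitz_unit Hdot HE k l)).
Qed.

Lemma msum_toeplitz_lim c a : bounded_operator a -> op_cvg (msum c) a ->
  toeplitz_algebra dot E a.
Proof.
by move=> bt ft; apply: (toeplitz_lim Hdot HE _ bt ft) => N; exact: msum_toeplitz.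
Qed.

Lemma rho_msum c N x : rho (msum c N) x =
  \sum_(k < N) \sum_(l < N) c k l *: (dot x (F l) *: F k).
Proof.
rewrite (rhoE Hdot HE det1 Hrho HrhoU (msum_toeplitz c N)) /=.
have [lV _ _] := moebV_bop Hdot HE det1.
rewrite (lin_sum _ lV); apply: eq_bigr => k _.
rewrite (lin_sum _ lV); apply: eq_bigr => l _.
rewrite (linZ _ _ lV) -(rho_unitE Hdot HE det1 Hrho HrhoU k l).
by rewrite (rhoE Hdot HE det1 Hrho HrhoU (toeplitz_unit Hdot HE k l)).
Qed.

Lemma rho_smooth_compact a : smooth_compact dot E a -> smooth_compact dot E (rho a).
Proof.
move=> [ba [c [dc ca]]].
have Ta := msum_toeplitz_lim ba ca.
have ra := rho_op_cvg Hdot HE det1 Hrho HrhoU (msum_toeplitz c) Ta ca.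
have [M bM] : exists M, bop M (rho a).
  by apply: (toeplitz_bop Hdot HE); case: Hrho => -[+ _ _] _ _ _; apply.
split; first exact: bop_bounded bM.
pose c' m n := dot (rho a (E n)) (E m).
have dc' : rapid_decay c'.
  apply/rapid_decayP => p q.
  have [C1 C10 HC1] := moebF_decay Hdot HE det1 p.
  have [C2 C20 HC2] := moebF_decay Hdot HE det1 q.
  have [C C0 HC] := rapid_decay_sum p q dc.
  (* [C1] and [C2] convert the weights in [m] and [n] into the same powers of 1 + k and 1 + l, and
     [C] bounds the double sum of [c] with those weights. *)
  exists (C1 * C2 * C) => m n.
  have -> : (1 + m)%:R ^+ p * (1 + n)%:R ^+ q * nr (c' m n) =
    nr ((1 + m)%:R ^+ p * (1 + n)%:R ^+ q * c' m n) by rewrite !nrM !nrX !nr_nat.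
  apply: (cv_nr_le _ (cvM' _ (cv_dotl Hdot (E m) (op_cvg_cv (E n) ra)))) => N.
  rewrite !nrM !nrX !nr_nat.
  apply: (@le_trans _ _ (C1 * C2 *
    \sum_(k < N) \sum_(l < N) (1 + k)%:R ^+ p * (1 + l)%:R ^+ q * nr (c k l))); last first.
    by rewrite ler_wpM2l // mulr_ge0.
  rewrite rho_msum dot_suml.
  have pq0 : 0 <= (1 + m)%:R ^+ p * (1 + n)%:R ^+ q :> R by rewrite mulr_ge0 ?exprn_ge0.
  apply: (le_trans (ler_wpM2l pq0 (nr_sum _ _ _))).
  rewrite !mulr_sumr; apply: ler_sum => k _; rewrite dot_suml.
  apply: (le_trans (ler_wpM2l pq0 (nr_sum _ _ _))).
  rewrite !mulr_sumr; apply: ler_sum => l _.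
  rewrite !dotZl !nrM (dotC _ (E n)) nr_conj.
  have h1 := HC1 k m; have h2 := HC2 l n.
  have -> : (1 + m)%:R ^+ p * (1 + n)%:R ^+ q *
      (nr (c k l) * (nr (dot (F l) (E n)) * nr (dot (F k) (E m)))) =
    ((1 + m)%:R ^+ p * nr (dot (F k) (E m))) *
    ((1 + n)%:R ^+ q * nr (dot (F l) (E n))) * nr (c k l) by ring.
  have -> : C1 * C2 * ((1 + k)%:R ^+ p * (1 + l)%:R ^+ q * nr (c k l)) =
    (C1 * (1 + k)%:R ^+ p) * (C2 * (1 + l)%:R ^+ q) * nr (c k l) by ring.
  by rewrite ler_wpM2r ?nr_ge0 // ler_pM // mulr_ge0 ?exprn_ge0 ?nr_ge0.
exists c'; split => //.
(* The decaying matrix defines an operator of its own; sharing all matrix entries with [rho a], it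
   equals [rho a]. *)
have [a' [ba' ca']] := msum_cvg dc'.
have [M' bM'] := bounded_bop ba'.
rewrite (_ : rho a = a') //; apply: (bop_ext Hdot oE tE bM bM') => j.
by apply: (total_ext tE) => i; rewrite (msum_coef i j ca').
Qed.

End Compact.

(** * Fourier coefficients of smooth periodic functions *)

Section Integral01.
Context (R : realType).
Implicit Types (u v F f : R -> R).

Definition int01 u : R := (\int[@lebesgue_measure R]_(x in `[0, 1]) u x)%R.

Lemma integrable01 u : continuous u ->
  (@lebesgue_measure R).-integrable `[0, 1] (EFin \o u).
Proof.
move=> cu; apply: continuous_compact_integrable; first exact: segment_compact.
exact: continuous_subspaceT.
Qed.

Lemma int01D u v : continuous u -> continuous v ->
  int01 (fun x => u x + v x) = int01 u + int01 v.
Proof. by move=> cu cv; apply: RintegralD => //; exact: integrable01. Qed.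

Lemma int01Z c u : continuous u -> int01 (fun x => c * u x) = c * int01 u.
Proof. by move=> cu; apply: RintegralZl => //; exact: integrable01. Qed.

Lemma int01_cst c : int01 (fun=> c) = c.
Proof.
by rewrite /int01 Rintegral_cst //= lebesgue_measure_itv /= lte_fin ltr01 oppr0 adde0 mulr1.
Qed.

Lemma int01_le u v : continuous u -> continuous v ->
  (forall x, `|u x| <= v x) -> `|int01 u| <= int01 v.
Proof.
move=> cu cv uv; apply: (le_trans (le_normr_Rintegral _ _)) => //.
  exact: integrable01.
apply: le_Rintegral => //; last exact: integrable01.
apply: (@integrable01 (fun x => `|u x|)) => x.
by apply: cvg_norm; exact: cu.
Qed.

Lemma is_derive_continuous F f : (forall x : R, is_derive x 1 F (f x)) -> continuous F.
Proof.
move=> dF x; apply: differentiable_continuous; apply/derivable1_diffP.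
by have [] := dF x.
Qed.

Lemma int01_FTC F f : (forall x : R, is_derive x 1 F (f x)) -> continuous f ->
  int01 f = F 1 - F 0.
Proof.
move=> dF cf; have cF := is_derive_continuous dF.
rewrite /int01 /Rintegral (@continuous_FTC2 _ f F 0 1) //.
- exact: continuous_subspaceT.
- split.
  + by move=> x _; have [] := dF x.
  + by apply: cvg_at_right_filter; exact: cF.
  + by apply: cvg_at_left_filter; exact: cF.
- by move=> x _; rewrite derive1E; have [_ ->] := dF x.
Qed.

Lemma is_derive_cosM (w x : R) : is_derive x 1 (fun x => cos (w * x)) (- w * sin (w * x)).
Proof.
have h : is_derive x 1 (fun x => w * x) w.
  by apply: is_derive_eq; rewrite [_ *: _]mulr1.
have := @is_derive1_comp R cos (fun x => w * x) x _ _ (is_derive_cos _) h.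
by move=> k; apply: is_derive_eq; rewrite mulrC mulrN mulNr.
Qed.

Lemma is_derive_sinM (w x : R) : is_derive x 1 (fun x => sin (w * x)) (w * cos (w * x)).
Proof.
have h : is_derive x 1 (fun x => w * x) w.
  by apply: is_derive_eq; rewrite [_ *: _]mulr1.
have := @is_derive1_comp R sin (fun x => w * x) x _ _ (is_derive_sin _) h.
by move=> k; apply: is_derive_eq; rewrite mulrC.
Qed.

Lemma continuous_cosM (w : R) : continuous (fun x : R => cos (w * x)).
Proof. exact: (is_derive_continuous (is_derive_cosM w)). Qed.

Lemma continuous_sinM (w : R) : continuous (fun x : R => sin (w * x)).
Proof. exact: (is_derive_continuous (is_derive_sinM w)). Qed.

Lemma is_deriveM1 F f u v (x : R) : is_derive x 1 F (f x) -> is_derive x 1 u (v x) ->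
  is_derive x 1 (fun t => F t * u t) (F x * v x + f x * u x).
Proof.
move=> dF du; have := is_deriveM dF du.
by move=> k; apply: is_derive_eq; rewrite /= [u x *: _]mulrC.
Qed.

(* [w] plays the role of a frequency [2 pi n]. *)
Lemma int01_cos_by_parts w F f : cos w = 1 -> sin w = 0 -> F 1 = F 0 ->
  (forall x : R, is_derive x 1 F (f x)) -> continuous f ->
  w * int01 (fun x => F x * cos (w * x)) = - int01 (fun x => f x * sin (w * x)).
Proof.
move=> cw sw F10 dF cf; have cF := is_derive_continuous dF.
have cM u v : continuous u -> continuous v -> continuous (fun x : R => u x * v x).
  by move=> cu cv x; apply: cvgM; [exact: cu|exact: cv].
have c1 : continuous (fun x => F x * cos (w * x)) by apply: cM => //; exact: continuous_cosM.
have c2 : continuous (fun x => f x * sin (w * x)) by apply: cM => //; exact: continuous_sinM.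
have c3 : continuous (fun x => w * (F x * cos (w * x))) by apply: cM => //; exact: cst_continuous.
have := @int01_FTC _ (fun x => F x * (w * cos (w * x)) + f x * sin (w * x))
  (fun x : R => @is_deriveM1 F f _ (fun x => w * cos (w * x)) x (dF x) (is_derive_sinM w x)).
rewrite (_ : (fun x => _ + _) = (fun x => w * (F x * cos (w * x)) + f x * sin (w * x))).
  move=> /(_ (fun x => cvgD (c3 x) (c2 x))).
  rewrite mulr0 sin0 mulr1 sw !mulr0 subr0 int01D // int01Z // => h.
  by apply/eqP; rewrite -addr_eq0 h.
by apply/funext => x; rewrite mulrCA.
Qed.

Lemma int01_sin_by_parts w F f : cos w = 1 -> sin w = 0 -> F 1 = F 0 ->
  (forall x : R, is_derive x 1 F (f x)) -> continuous f ->
  w * int01 (fun x => F x * sin (w * x)) = int01 (fun x => f x * cos (w * x)).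
Proof.
move=> cw sw F10 dF cf; have cF := is_derive_continuous dF.
have cM u v : continuous u -> continuous v -> continuous (fun x : R => u x * v x).
  by move=> cu cv x; apply: cvgM; [exact: cu|exact: cv].
have c1 : continuous (fun x => F x * sin (w * x)) by apply: cM => //; exact: continuous_sinM.
have c2 : continuous (fun x => f x * cos (w * x)) by apply: cM => //; exact: continuous_cosM.
have c3 : continuous (fun x => - w * (F x * sin (w * x))) by apply: cM => //; exact: cst_continuous.
have := @int01_FTC _ (fun x => F x * (- w * sin (w * x)) + f x * cos (w * x))
  (fun x : R => @is_deriveM1 F f _ (fun x => - w * sin (w * x)) x (dF x) (is_derive_cosM w x)).
rewrite (_ : (fun x => _ + _) = (fun x => - w * (F x * sin (w * x)) + f x * cos (w * x))).
  move=> /(_ (fun x => cvgD (c3 x) (c2 x))).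
  rewrite mulr0 cos0 mulr1 cw !mulr1 F10 subrr int01D // int01Z // mulNr => h.
  by apply/eqP; rewrite eq_sym -subr_eq0 addrC h.
by apply/funext => x; rewrite mulrCA.
Qed.

Definition smooth_per u := (forall x, u (x + 1) = u x) /\
  forall n (x : R), derivable (derive1n n u) x 1.

Lemma smooth_per_derive u : smooth_per u -> smooth_per (derive1 u).
Proof.
move=> [pu du]; split => [x|n x]; last by rewrite -derive1Sn; exact: du.
rewrite /derive1 (_ : (fun h => _) = (fun h => h^-1 *: (u (h + x) - u x))) //.
by apply/funext => h; rewrite addrA !pu.
Qed.

Lemma smooth_per_is_derive u (x : R) : smooth_per u -> is_derive x 1 u ((derive1 u) x).
Proof. by move=> [_ /(_ 0%N x) du]; rewrite derive1E; exact/derivableP. Qed.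

Lemma smooth_per_continuous u : smooth_per u -> continuous u.
Proof. by move=> su; exact: (is_derive_continuous (fun x => smooth_per_is_derive x su)). Qed.

(** Write 1 + |w| as a sum: the summand 1 keeps [u], and |w| is traded for the derivative by parts.
    Cosine and sine are treated together because each step exchanges them. *)
Lemma smooth_per_decay p u : smooth_per u -> exists C, forall w, cos w = 1 -> sin w = 0 ->
  (1 + `|w|) ^+ p * `|int01 (fun x => u x * cos (w * x))| <= C /\
  (1 + `|w|) ^+ p * `|int01 (fun x => u x * sin (w * x))| <= C.
Proof.
elim: p u => [|p IH] u su.
  have cu := smooth_per_continuous su.
  have cn : continuous (fun x => `|u x|) by move=> x; apply: cvg_norm; exact: cu.
  exists (int01 (fun x => `|u x|)) => w _ _; rewrite !expr0 !mul1r; split.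
    apply: int01_le => // [x|x].
      by apply: cvgM; [exact: cu|exact: continuous_cosM].
    by rewrite normrM -[leRHS]mulr1 ler_wpM2l // cos_max.
  apply: int01_le => // [x|x].
    by apply: cvgM; [exact: cu|exact: continuous_sinM].
  by rewrite normrM -[leRHS]mulr1 ler_wpM2l // sin_max.
have su' := smooth_per_derive su.
have [C HC] := IH _ su; have [C' HC'] := IH _ su'.
exists (C + C') => w cw sw; have [hc hs] := HC w cw sw; have [hc' hs'] := HC' w cw sw.
have u10 : u 1 = u 0 by case: su => + _ => /(_ 0); rewrite add0r.
have du x := smooth_per_is_derive x su.
have cu' := smooth_per_continuous su'.
have pc := int01_cos_by_parts cw sw u10 du cu'.
have ps := int01_sin_by_parts cw sw u10 du cu'.
rewrite exprSr -!mulrA !(mulrDl 1) !mul1r -!normrM pc ps normrN !mulrDr.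
by split; apply: lerD.
Qed.

End Integral01.

(** * Complex integrals and orthogonality of the exponentials *)

Section Frequencies.
Context (R : realType).

Lemma cos_freq (z : int) : cos (2 * pi * z%:~R : R) = 1.
Proof.
have nat_case n : cos (2 * pi * n%:R : R) = 1.
  transitivity (cos (0 + pi *+ 2 *+ n : R)).
    by rewrite add0r -[in RHS]mulr_natr -(mulr_natl pi 2).
  by rewrite (periodicn (@cosD2pi R)) cos0.
by case: z => n; rewrite ?NegzE ?mulrNz ?mulrN ?cosN; exact: nat_case.
Qed.

Lemma sin_freq (z : int) : sin (2 * pi * z%:~R : R) = 0.
Proof. by apply: cos1sin0; rewrite cos_freq normr1. Qed.

Lemma nr_i : nr ('i%C : R[i]) = 1.
Proof. by rewrite /nr normc_def /= expr0n expr1n add0r sqrtr1. Qed.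

Lemma nr_Re (z : R[i]) : `|complex.Re z| <= nr z.
Proof. by rewrite -lecR nrE normc_ge_Re. Qed.

Lemma nr_Im (z : R[i]) : `|complex.Im z| <= nr z.
Proof. by have := nr_Re (z * 'i%C); rewrite ReiNIm normrN nrM nr_i mulr1. Qed.

Lemma nr_complex (a b : R) : nr (a +i* b : R[i]) <= `|a| + `|b|.
Proof.
rewrite (_ : a +i* b = a%:C + 'i%C * b%:C); last by simpc.
apply: (le_trans (nrD _ _)); by rewrite nrM !nr_real nr_i mul1r.
Qed.

Lemma continuousD' (u v : R -> R) : continuous u -> continuous v ->
  continuous (fun x => u x + v x).
Proof. by move=> cu cv x; apply: cvgD; [exact: cu|exact: cv]. Qed.

Lemma continuousB' (u v : R -> R) : continuous u -> continuous v ->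
  continuous (fun x => u x - v x).
Proof. by move=> cu cv x; apply: cvgB; [exact: cu|exact: cv]. Qed.

Lemma continuousM' (u v : R -> R) : continuous u -> continuous v ->
  continuous (fun x => u x * v x).
Proof. by move=> cu cv x; apply: cvgM; [exact: cu|exact: cv]. Qed.

Lemma continuousZ' (c : R) (v : R -> R) : continuous v -> continuous (fun x => c * v x).
Proof. by move=> cv; apply: (@continuousM' (fun=> c)) => //; exact: cst_continuous. Qed.

Lemma int01B (u v : R -> R) : continuous u -> continuous v ->
  int01 (fun x => u x - v x) = int01 u - int01 v.
Proof.
move=> cu cv; rewrite -[- int01 v]mulN1r -int01Z // -int01D //; last exact: continuousZ'.
by congr int01; apply/funext => x; rewrite mulN1r.
Qed.

Definition cint (h : R -> R[i]) : R[i] :=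
  int01 (fun x => complex.Re (h x)) +i* int01 (fun x => complex.Im (h x)).

Definition ccont (h : R -> R[i]) :=
  continuous (fun x => complex.Re (h x)) /\ continuous (fun x => complex.Im (h x)).

Lemma ReD (a b : R[i]) : complex.Re (a + b) = complex.Re a + complex.Re b.
Proof. by case: a b => [? ?] [? ?]. Qed.
Lemma ImD (a b : R[i]) : complex.Im (a + b) = complex.Im a + complex.Im b.
Proof. by case: a b => [? ?] [? ?]. Qed.
Lemma ReM (a b : R[i]) : complex.Re (a * b) =
  complex.Re a * complex.Re b - complex.Im a * complex.Im b.
Proof. by case: a b => [? ?] [? ?]. Qed.
Lemma ImM (a b : R[i]) : complex.Im (a * b) =
  complex.Re a * complex.Im b + complex.Im a * complex.Re b.
Proof. by case: a b => [? ?] [? ?]. Qed.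

Lemma ccontD h k : ccont h -> ccont k -> ccont (fun x => h x + k x).
Proof.
move=> [h1 h2] [k1 k2]; split; under eq_fun do rewrite ?ReD ?ImD;
  exact: continuousD'.
Qed.

Lemma ccontM h k : ccont h -> ccont k -> ccont (fun x => h x * k x).
Proof.
move=> [h1 h2] [k1 k2]; split; under eq_fun do rewrite ?ReM ?ImM.
  by apply: continuousB'; exact: continuousM'.
by apply: continuousD'; exact: continuousM'.
Qed.

Lemma ccont_cst (c : R[i]) : ccont (fun=> c).
Proof. by split; exact: cst_continuous. Qed.

Lemma cintD h k : ccont h -> ccont k -> cint (fun x => h x + k x) = cint h + cint k.
Proof.
move=> [h1 h2] [k1 k2]; rewrite /cint.
have -> : (fun x => complex.Re (h x + k x)) =
  fun x => complex.Re (h x) + complex.Re (k x) by apply/funext => x; rewrite ReD.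
have -> : (fun x => complex.Im (h x + k x)) =
  fun x => complex.Im (h x) + complex.Im (k x) by apply/funext => x; rewrite ImD.
by rewrite !int01D.
Qed.

Lemma cintZ c h : ccont h -> cint (fun x => c * h x) = c * cint h.
Proof.
move=> [h1 h2]; rewrite /cint.
have -> : (fun x => complex.Re (c * h x)) =
  fun x => complex.Re c * complex.Re (h x) - complex.Im c * complex.Im (h x).
  by apply/funext => x; rewrite ReM.
have -> : (fun x => complex.Im (c * h x)) =
  fun x => complex.Re c * complex.Im (h x) + complex.Im c * complex.Re (h x).
  by apply/funext => x; rewrite ImM.
rewrite int01B ?int01D ?int01Z //; try exact: continuousZ'.
by case: c => a b /=; simpc.
Qed.

(** Real and imaginary parts are bounded separately, at the cost of a factor 2. *)
Lemma cint_le h (e : R) : ccont h -> (forall x, nr (h x) <= e) -> nr (cint h) <= e + e.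
Proof.
move=> [h1 h2] he; apply: (le_trans (nr_complex _ _)).
rewrite -(int01_cst e); apply: lerD; apply: int01_le => //; try exact: cst_continuous.
  by move=> x; apply: le_trans (nr_Re _) (he x).
by move=> x; apply: le_trans (nr_Im _) (he x).
Qed.

Definition wave (z : int) (x : R) : R[i] := expi (2 * pi * z%:~R * x).

Lemma ccont_wave z : ccont (wave z).
Proof. split; [exact: continuous_cosM|exact: continuous_sinM]. Qed.

Lemma waveD y z x : wave y x * wave z x = wave (y + z) x.
Proof.
rewrite /wave /expi intrD (mulrDr (2 * pi)) mulrDl cosD sinD.
by apply/eqP; rewrite eq_complex /= eqxx (addrC (sin _ * _)) eqxx.
Qed.

Lemma cint_wave z : cint (wave z) = (z == 0)%:R.
Proof.
rewrite /cint /wave /=; have [->|z0] := eqVneq z 0.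
  have -> : (fun x : R => cos (2 * pi * 0%:~R * x)) = fun=> 1.
    by apply/funext => x; rewrite mulr0 mul0r cos0.
  have -> : (fun x : R => sin (2 * pi * 0%:~R * x)) = fun=> 0.
    by apply/funext => x; rewrite mulr0 mul0r sin0.
  by rewrite !int01_cst.
have := cos_freq z; have := sin_freq z; set w := 2 * pi * z%:~R => sw cw.
have w0 : w != 0 by rewrite /w !mulf_neq0 ?pnatr_eq0 ?intr_eq0 // gt_eqF // pi_gt0.
have d1 (x : R) : is_derive x 1 (fun _ : R => 1 : R) ((fun _ : R => 0 : R) x) by exact: is_derive_cst.
have c0 : continuous (fun _ : R => 0 : R) by exact: cst_continuous.
have zero (f : R -> R) : int01 (fun x => 0 * f x) = 0.
  by rewrite -[RHS](int01_cst 0); congr int01; apply/funext => x; rewrite mul0r.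
have one (f : R -> R) : int01 (fun x => 1 * f x) = int01 f.
  by congr int01; apply/funext => x; rewrite mul1r.
(* Integration by parts against the constant 1, whose derivative is 0, shows that w times each
   integral vanishes. *)
have := @int01_cos_by_parts R w (fun=> 1) (fun=> 0) cw sw erefl d1 c0.
have := @int01_sin_by_parts R w (fun=> 1) (fun=> 0) cw sw erefl d1 c0.
rewrite !zero !one oppr0 => hs hc.
by congr (_ +i* _); apply: (mulfI w0); rewrite mulr0.
Qed.

Lemma fourier_coefE f n : fourier_coef f n = cint (fun x => f x * wave (- n) x).
Proof.
have e (x : R) : - (2 * pi * n%:~R * x) = 2 * pi * (- n)%:~R * x.
  by rewrite mulrNz mulrN mulNr.
by rewrite /fourier_coef /cint /wave /int01; under eq_Rintegral do rewrite e;
  under [X in _ +i* X]eq_Rintegral do rewrite e.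
Qed.

End Frequencies.

(** * Fourier synthesis *)

Section FourierDecay.
Context (R : realType).

Lemma freq_ge (n : nat) : n%:R <= `|2 * pi * (n%:Z)%:~R| :> R.
Proof.
rewrite normrM ger0_norm ?mulr_ge0 ?pi_ge0 // [`|_|]ger0_norm ?ler0n //.
by rewrite ler_peMl //; have := pi_ge2 R; lra.
Qed.

Lemma fourier_decay f : smooth_periodic f -> rdecay (@fourier_coef R f).
Proof.
move=> [pf df] p.
pose u t := complex.Re (f t); pose v t := complex.Im (f t).
have su : smooth_per u.
  by split => [x|n x]; [rewrite /u pf|have [] := df n x].
have sv : smooth_per v.
  by split => [x|n x]; [rewrite /v pf|have [] := df n x].
have [C HC] := smooth_per_decay p su; have [D HD] := smooth_per_decay p sv.
have cu := smooth_per_continuous su; have cv := smooth_per_continuous sv.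
(* The real and the imaginary integral each contribute [C + D], one constant for each component of
   [f]. *)
have bound (n : nat) (z : int) : `|z|%N = n ->
    (1 + n)%:R ^+ p * nr (fourier_coef f z) <= C + D + (C + D).
  move=> zn; rewrite fourier_coefE /cint.
  have := cos_freq R (- z); have := sin_freq R (- z).
  set w := 2 * pi * (- z)%:~R => sw cw.
  have wn : (1 + n)%:R <= 1 + `|w| :> R.
    rewrite natrD lerD2l; apply: le_trans (freq_ge n) _.
    rewrite /w !normrM -!intr_norm normrN -zn; case: (z) => m; by [].
  have -> : (fun x => complex.Re (f x * wave (- z) x)) =
      fun x => u x * cos (w * x) - v x * sin (w * x).
    by apply/funext => x; rewrite ReM.
  have -> : (fun x => complex.Im (f x * wave (- z) x)) =
      fun x => u x * sin (w * x) + v x * cos (w * x).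
    by apply/funext => x; rewrite ImM.
  have cc := @continuous_cosM R w; have cs := @continuous_sinM R w.
  rewrite int01B ?int01D; try exact: continuousM'.
  have [uc us] := HC w cw sw; have [vc vs] := HD w cw sw.
  have pw : 0 <= (1 + n)%:R ^+ p :> R by rewrite exprn_ge0.
  have pww : (1 + n)%:R ^+ p <= (1 + `|w|) ^+ p by rewrite lerXn2r ?nnegrE ?addr_ge0.
  have mono (x : R) K : (1 + `|w|) ^+ p * `|x| <= K -> (1 + n)%:R ^+ p * `|x| <= K.
    by apply: le_trans; rewrite ler_wpM2r.
  apply: (le_trans (ler_wpM2l pw (nr_complex _ _))); rewrite mulrDr lerD //.
    apply: (le_trans (ler_wpM2l pw (ler_normB _ _))).
    by rewrite mulrDr lerD //; exact: mono.
  apply: (le_trans (ler_wpM2l pw (ler_normD _ _))).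
  by rewrite mulrDr lerD //; exact: mono.
exists (C + D + (C + D) + (C + D + (C + D))) => n; rewrite mulrDr lerD //.
  exact: bound.
by apply: bound; rewrite abszN.
Qed.

End FourierDecay.

(** * Rapidly decaying trigonometric series are smooth *)

Section TrigSeries.
Context (R : realType).
Implicit Types (a b : nat -> R).

Lemma mvt_bound (f df : R -> R) (k M : R) : (forall x : R, is_derive x 1 f (df x)) ->
  (forall t, `|t| <= `|k| -> `|df t| <= M) -> `|f k - f 0| <= M * `|k|.
Proof.
move=> fd dM; have cf := is_derive_continuous fd.
case: (leP 0 k) => k0.
  have [c] := @MVT_segment R f df 0 k k0 (fun x _ => fd x) (continuous_subspaceT cf).
  rewrite in_itv /= => /andP[c0 ck] ->; rewrite subr0 normrM ler_wpM2r //.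
  by apply: dM; rewrite !ger0_norm.
have [c] := @MVT_segment R f df k 0 (ltW k0) (fun x _ => fd x) (continuous_subspaceT cf).
rewrite in_itv /= => /andP[ck c0] e.
rewrite -opprB normrN e sub0r normrM normrN ler_wpM2r //.
by apply: dM; rewrite !ler0_norm ?(ltW k0) // lerN2.
Qed.

Lemma sin_le_norm (k : R) : `|sin k| <= `|k|.
Proof.
have := @mvt_bound sin cos k 1 (fun x => is_derive_sin x) (fun t _ => cos_max t).
by rewrite sin0 subr0 mul1r.
Qed.

Lemma cos1_le_norm (k : R) : `|cos k - 1| <= `|k|.
Proof.
have := @mvt_bound cos (fun x => - sin x) k 1 (fun x => is_derive_cos x).
by rewrite cos0 mul1r; apply => t _; rewrite normrN sin_max.
Qed.

Lemma cos1_le_sqr (k : R) : `|cos k - 1| <= k ^+ 2.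
Proof.
have := @mvt_bound cos (fun x => - sin x) k `|k| (fun x => is_derive_cos x).
rewrite cos0 -expr2 real_normK ?num_real //; apply => t tk.
by rewrite normrN (le_trans (sin_le_norm t)).
Qed.

Lemma sin_sub_le_sqr (k : R) : `|sin k - k| <= k ^+ 2.
Proof.
have d (x : R) : is_derive x 1 (fun t => sin t - t) (cos x - 1).
  exact: (is_deriveB (is_derive_sin x) (is_derive_id x 1)).
have := @mvt_bound (fun t => sin t - t) (fun t => cos t - 1) k `|k| d.
rewrite sin0 !subr0 -expr2 real_normK ?num_real //; apply => t tk.
by rewrite (le_trans (cos1_le_norm t)).
Qed.

(** A quadratic remainder bound holding for every increment survives limits of partial sums, so it
    yields termwise differentiation directly. *)
Lemma is_derive_quadratic (f : R -> R) (x l K : R) :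
  (forall h, `|f (x + h) - f x - h * l| <= K * h ^+ 2) -> is_derive x 1 f l.
Proof.
move=> fK.
have K0 : 0 <= K by have := fK 1; rewrite expr1n mulr1; apply: le_trans.
have cl : h^-1 *: ((f \o shift x) (h *: (1 : R)) - f x) @[h --> (0 : R)^'] --> l.
  apply/cvgrPdist_le => e e0; near=> h.
  have h0 : h != 0 by near: h; exact: nbhs_dnbhs_neq.
  have -> : l - h^-1 *: ((f \o shift x) (h *: (1 : R)) - f x) =
    - (h^-1 * (f (x + h) - f x - h * l)).
    rewrite /= [h *: 1]mulr1 (addrC h) [_ *: _]/(_ * _) mulrBr.
    by rewrite mulKf // opprB.
  rewrite normrN normrM; apply: (le_trans (ler_wpM2l _ (fK h))) => //.
  rewrite -(real_normK (num_real h)) normfV mulrCA expr2 mulKf ?normr_eq0 //.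
  apply: (@le_trans _ _ ((K + 1) * `|h|)); first by rewrite ler_wpM2r // lerDl.
  rewrite mulrC -ler_pdivlMr ?ltr_wpDl //.
  by near: h; apply: dnbhs0_le; rewrite divr_gt0 // ltr_wpDl.
have dv : derivable f x 1 by apply/cvg_ex; exists l.
by apply: DeriveDef => //; apply: (cvg_lim _ cl).
Unshelve. all: by end_near. Qed.

(* Pairing the frequencies [n] and [-n], the series below is the real form of
   a two-sided Fourier series. *)
Definition trig_term a b (n : nat) (x : R) : R :=
  a n * cos (2 * pi * (n%:Z)%:~R * x) + b n * sin (2 * pi * (n%:Z)%:~R * x).

Definition trig a b (x : R) : R := limn (series (fun n => trig_term a b n x)).

Definition real_decay a := forall p, exists C : R, forall n, (1 + n)%:R ^+ p * `|a n| <= C.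

Lemma real_decay_sum a b p : real_decay a -> real_decay b -> exists B, forall N,
  \sum_(n < N) (1 + n)%:R ^+ p * (`|a n| + `|b n|) <= B.
Proof.
move=> da db; have [C HC] := da (p + 2)%N; have [D HD] := db (p + 2)%N.
exists ((C + D) * 2) => N.
apply: (@decay_sum R (fun n => `|a n| + `|b n|)) => n; first by rewrite addr_ge0.
by rewrite mulrDr lerD.
Qed.

Lemma trig_term_le a b n x : `|trig_term a b n x| <= `|a n| + `|b n|.
Proof.
apply: (le_trans (ler_normD _ _)); rewrite !normrM.
by apply: lerD; rewrite -[leRHS]mulr1 ler_wpM2l // ?cos_max ?sin_max.
Qed.

Lemma trig_cvg a b x : real_decay a -> real_decay b ->
  series (fun n => trig_term a b n x) @ \oo --> trig a b x.
Proof.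
move=> da db; have [B HB] := real_decay_sum 0 da db.
have : cvgn (series (fun n => trig_term a b n x)); last by [].
apply: normed_cvg; apply: nondecreasing_is_cvgn.
  by apply: nondecreasing_series => n _ _; exact: normr_ge0.
exists B => _ [N _ <-].
rewrite (_ : [normed series _] N = \sum_(n < N) `|trig_term a b n x|); last first.
  by rewrite -(big_mkord xpredT (fun n => `|trig_term a b n x|)).
apply: le_trans (HB N).
by apply: ler_sum => n _; rewrite expr0 mul1r trig_term_le.
Qed.

Lemma cvg_norm_le (u : nat -> R) l M : (forall n, `|u n| <= M) -> u @ \oo --> l ->
  `|l| <= M.
Proof.
move=> uM /cvg_norm ul; apply: (ler_cvg_to ul (cvg_cst M)).
by apply: nearW => n; exact: uM.
Qed.

Lemma trig_tail a b : real_decay a -> real_decay b -> forall e : R, 0 < e ->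
  exists N0, forall N x, (N0 <= N)%N ->
    `|trig a b x - series (fun n => trig_term a b n x) N| <= e.
Proof.
move=> da db e e0; have [B HB] := real_decay_sum 0 da db.
have b0 n : 0 <= `|a n| + `|b n| by rewrite addr_ge0.
have [|N0 HN0] := @sum_tail_small R (fun n => `|a n| + `|b n|) B b0 _ e e0.
  by move=> N; apply: le_trans (HB N); apply: ler_sum => n _; rewrite expr0 mul1r.
exists N0 => N x N0N; pose s := series (fun n => trig_term a b n x).
have h : (fun m => s (m + N)%N - s N) @ \oo --> trig a b x - s N.
  apply: cvgB; last exact: cvg_cst.
  by rewrite (cvg_shiftn N s); exact: trig_cvg.
apply: cvg_norm_le h => m; rewrite sub_series_geq ?leq_addl //.
apply: (le_trans (ler_norm_sum _ _ _)).
apply: le_trans (HN0 N (m + N)%N N0N (leq_addl _ _)).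
by apply: ler_sum => n _; exact: trig_term_le.
Qed.

(** Cosine and sine coefficients of the termwise derivative: differentiation exchanges the two
    families with factor 2 pi n. *)
Definition trig_da b (n : nat) : R := 2 * pi * (n%:Z)%:~R * b n.
Definition trig_db a (n : nat) : R := - (2 * pi * (n%:Z)%:~R * a n).

Lemma trig_da_decay b : real_decay b -> real_decay (trig_da b).
Proof.
move=> db p; have [C HC] := db p.+1; exists (2 * pi * C) => n.
have p0 : 0 <= 2 * pi :> R by rewrite mulr_ge0 ?pi_ge0.
rewrite /trig_da !normrM -[`|2| * _]normrM (ger0_norm p0) [`|_%:~R|]ger0_norm ?ler0n //.
rewrite -[2 * pi * _ * _]mulrA mulrCA ler_wpM2l //; apply: le_trans (HC n).
rewrite exprSr -mulrA ler_wpM2l ?exprn_ge0 // ler_wpM2r //.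
by rewrite [_%:~R]/(n%:R) ler_nat leq_addl.
Qed.

Lemma trig_db_decay a : real_decay a -> real_decay (trig_db a).
Proof.
move=> /trig_da_decay da p; have [C HC] := da p; exists C => n.
by rewrite /trig_db normrN; exact: HC.
Qed.

Lemma cos_quadratic (y k : R) : `|cos (y + k) - cos y + k * sin y| <= 2 * k ^+ 2.
Proof.
have -> : cos (y + k) - cos y + k * sin y = cos y * (cos k - 1) - sin y * (sin k - k).
  by rewrite cosD; ring.
apply: (le_trans (ler_normB _ _)); rewrite !normrM mulr_natl mulr2n lerD //.
  by rewrite -[leRHS]mul1r ler_pM // ?cos_max ?cos1_le_sqr.
by rewrite -[leRHS]mul1r ler_pM // ?sin_max ?sin_sub_le_sqr.
Qed.

Lemma sin_quadratic (y k : R) : `|sin (y + k) - sin y - k * cos y| <= 2 * k ^+ 2.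
Proof.
have -> : sin (y + k) - sin y - k * cos y = sin y * (cos k - 1) + cos y * (sin k - k).
  by rewrite sinD; ring.
apply: (le_trans (ler_normD _ _)); rewrite !normrM mulr_natl mulr2n lerD //.
  by rewrite -[leRHS]mul1r ler_pM // ?sin_max ?cos1_le_sqr.
by rewrite -[leRHS]mul1r ler_pM // ?cos_max ?sin_sub_le_sqr.
Qed.

Lemma trig_is_derive a b (x : R) : real_decay a -> real_decay b ->
  is_derive x 1 (trig a b) (trig (trig_da b) (trig_db a) x).
Proof.
move=> da db; have [B HB] := real_decay_sum 2 da db.
have da' := trig_da_decay db; have db' := trig_db_decay da.
(* The n-th term has increment k = 2 pi n h and remainder at most 2 k^2 times its coefficients; [B]
   sums those against (1 + n)^2, hence the exponent 2 above. *)
apply: (@is_derive_quadratic _ _ _ (2 * (2 * pi) ^+ 2 * B)) => h.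
have hc : (fun N => series (fun n => trig_term a b n (x + h)) N -
      series (fun n => trig_term a b n x) N -
      h * series (fun n => trig_term (trig_da b) (trig_db a) n x) N) @ \oo -->
    trig a b (x + h) - trig a b x - h * trig (trig_da b) (trig_db a) x.
  apply: cvgB; first by apply: cvgB; exact: trig_cvg.
  by apply: cvgMr; exact: trig_cvg.
apply: (cvg_norm_le _ hc) => N.
rewrite /series /= mulr_sumr -!sumrB.
apply: (le_trans (ler_norm_sum _ _ _)); rewrite big_mkord.
have K0 : 0 <= 2 * (2 * pi) ^+ 2 * h ^+ 2 :> R.
  by rewrite mulr_ge0 ?sqr_ge0 // mulr_ge0 ?sqr_ge0.
rewrite [leRHS]mulrAC; apply: le_trans (ler_wpM2l K0 (HB N)).
rewrite mulr_sumr; apply: ler_sum => n _.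
rewrite /trig_term /trig_da /trig_db [_%:~R]/(n%:R); set w := 2 * pi * n%:R.
rewrite mulrDr; set y := w * x; set k := w * h.
have -> : a n * cos (y + k) + b n * sin (y + k) - (a n * cos y + b n * sin y) -
    h * (w * b n * cos y + - (w * a n) * sin y) =
  a n * (cos (y + k) - cos y + k * sin y) + b n * (sin (y + k) - sin y - k * cos y).
  by rewrite /k; ring.
have k2 : 2 * k ^+ 2 <= 2 * (2 * pi) ^+ 2 * h ^+ 2 * (1 + n)%:R ^+ 2.
  have -> : 2 * k ^+ 2 = 2 * (2 * pi) ^+ 2 * h ^+ 2 * n%:R ^+ 2 by rewrite /k /w; ring.
  rewrite ler_wpM2l //.
  by rewrite lerXn2r ?nnegrE ?ler_nat ?leq_addl.
apply: (le_trans (ler_normD _ _)); rewrite !normrM mulrA mulrDr lerD //.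
  by rewrite mulrC ler_wpM2r // (le_trans (cos_quadratic _ _)).
by rewrite mulrC ler_wpM2r // (le_trans (sin_quadratic _ _)).
Qed.

Lemma trig_smooth_per a b : real_decay a -> real_decay b -> smooth_per (trig a b).
Proof.
move=> da db; split => [x|n].
  congr (limn (series _)); apply/funext => n; rewrite /trig_term mulrDr mulr1.
  by rewrite cosD sinD cos_freq sin_freq !mulr1 !mulr0 subr0 addr0.
have [a' [b' [-> da' db']]] : exists a' b',
    [/\ derive1n n (trig a b) = trig a' b', real_decay a' & real_decay b'].
  elim: n => [|n [a' [b' [e da' db']]]]; first by exists a, b.
  exists (trig_da b'), (trig_db a'); split; [|exact: trig_da_decay|exact: trig_db_decay].
  rewrite derive1nS e; apply/funext => x; rewrite derive1E.
  by have [_ ->] := trig_is_derive x da' db'.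
by move=> x; have [] := trig_is_derive x da' db'.
Qed.

End TrigSeries.

Section Synthesis.
Context (R : realType).

Lemma fourier_synthesis (g : int -> R[i]) : rdecay g ->
  exists2 f, smooth_periodic f & fourier_coef f = g.
Proof.
move=> dg.
(* Real ([a1], [b1]) and imaginary ([a2], [b2]) parts of g_n e^{it} + g_{-n} e^{-it}, sorted by cos
   t and sin t. *)
pose a1 n := complex.Re (g n%:Z) + complex.Re (negcoef g n).
pose b1 n := complex.Im (negcoef g n) - complex.Im (g n%:Z).
pose a2 n := complex.Im (g n%:Z) + complex.Im (negcoef g n).
pose b2 n := complex.Re (g n%:Z) - complex.Re (negcoef g n).
have dec (c : nat -> R) : (forall n, `|c n| <= nr (g n%:Z) + nr (negcoef g n)) -> real_decay c.
  move=> cg p; have [C HC] := dg p; exists C => n; apply: le_trans (HC n).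
  rewrite ler_wpM2l ?exprn_ge0 //; apply: (le_trans (cg n)).
  by rewrite lerD2l nr_negcoef.
have da1 : real_decay a1 by apply: dec => n; rewrite (le_trans (ler_normD _ _)) // lerD ?nr_Re ?nr_Im.
have db1 : real_decay b1 by apply: dec => n; rewrite (le_trans (ler_normB _ _)) // addrC lerD ?nr_Re ?nr_Im.
have da2 : real_decay a2 by apply: dec => n; rewrite (le_trans (ler_normD _ _)) // lerD ?nr_Re ?nr_Im.
have db2 : real_decay b2 by apply: dec => n; rewrite (le_trans (ler_normB _ _)) // lerD ?nr_Re ?nr_Im.
pose f x := trig a1 b1 x +i* trig a2 b2 x.
have [p1 s1] := trig_smooth_per da1 db1; have [p2 s2] := trig_smooth_per da2 db2.
exists f; first by split => [x|n x]; [rewrite /f p1 p2|split; [exact: s1|exact: s2]].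
have cf : ccont f.
  by split; [exact: (smooth_per_continuous (trig_smooth_per da1 db1))
            |exact: (smooth_per_continuous (trig_smooth_per da2 db2))].
pose S N x := \sum_(n < N) (g n%:Z * wave n%:Z x + negcoef g n * wave (- n%:Z) x).
have SE N x : S N x = series (fun n => trig_term a1 b1 n x) N +i*
                      series (fun n => trig_term a2 b2 n x) N.
  rewrite /S /series /= !big_mkord; elim: N => [|N IH]; first by rewrite !big_ord0.
  rewrite !big_ord_recr /= IH /trig_term /wave /expi mulrNz mulrN mulNr cosN sinN.
  rewrite /a1 /b1 /a2 /b2; case: (g N%:Z) => p q; case: (negcoef g N) => r s /=; simpc.
  by congr (_ +i* _); ring.
have cS N : ccont (S N).
  rewrite /S; elim: N => [|N IH].
    by rewrite (_ : (fun x => _) = fun=> 0); [exact: ccont_cst|apply/funext => x; rewrite big_ord0].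
  rewrite (_ : (fun x => _) = fun x => S N x +
    (g N%:Z * wave N%:Z x + negcoef g N * wave (- N%:Z) x)).
    apply: ccontD IH _; apply: ccontD; apply: ccontM; try exact: ccont_cst; exact: ccont_wave.
  by apply/funext => x; rewrite big_ord_recr.
apply/funext => z; rewrite fourier_coefE.
have cw c y : ccont (fun x => c * wave y x) by apply: ccontM; [exact: ccont_cst|exact: ccont_wave].
(* Orthogonality makes the coefficient of a partial sum exact once N exceeds |z|; only the uniform
   error of the partial sum remains. *)
have coefS N : (`|z| < N)%N -> cint (fun x => S N x * wave (- z) x) = g z.
  have partial M : cint (fun x => S M x * wave (- z) x) =
      \sum_(n < M) (g n%:Z * (n%:Z == z)%:R + negcoef g n * (- n%:Z == z)%:R).
    elim: M => [|M IH].
      rewrite big_ord0 (_ : (fun x => _) = fun=> 0); first by rewrite /cint /= !int01_cst.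
      by apply/funext => x; rewrite /S big_ord0 mul0r.
    rewrite big_ord_recr /= -IH.
    rewrite (_ : (fun x => _) = fun x => S M x * wave (- z) x +
      (g M%:Z * wave (M%:Z - z) x + negcoef g M * wave (- M%:Z - z) x)); last first.
      by apply/funext => x; rewrite /S big_ord_recr /= mulrDl mulrDl -!mulrA !waveD.
    rewrite cintD; [|by apply: ccontM; [exact: cS|exact: ccont_wave]|by apply: ccontD; exact: cw].
    by rewrite cintD // !cintZ ?cint_wave ?subr_eq0 //; exact: ccont_wave.
  move=> zN; rewrite partial (bigD1 (Ordinal zN)) //= big1 ?addr0.
    case: z zN {partial} => n zN /=; first rewrite eqxx mulr1.
      by case: n {zN} => [|n]; rewrite ?mul0r ?addr0 //= mulr0 addr0.
    by rewrite NegzE /= eqxx mulr1 mulr0 add0r.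
  move=> i; rewrite -val_eqE /= => iz.
  have -> : (i%:Z == z) = false by apply: contraNF iz => /eqP <-.
  have -> : (- (i%:Z) == z) = false by apply: contraNF iz => /eqP <-; rewrite abszN.
  by rewrite !mulr0 addr0.
apply/eqP; rewrite -subr_eq0; apply/eqP/nr_eq0/eqP; rewrite eq_le nr_ge0 andbT.
apply/ler_addgt0Pl => e e0; rewrite addr0.
(* Each of the two real series errs by at most e/4, and [cint_le] doubles their total. *)
have e4 : 0 < e / 4 by rewrite divr_gt0.
have [N1 H1] := trig_tail da1 db1 e4; have [N2 H2] := trig_tail da2 db2 e4.
pose N := maxn (maxn N1 N2) (`|z|%N.+1).
have zN : (`|z| < N)%N by rewrite /N leq_maxr.
have N1N : (N1 <= N)%N by rewrite /N !leq_max leqnn.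
have N2N : (N2 <= N)%N by rewrite /N !leq_max leqnn orbT.
have cfw : ccont (fun x => f x * wave (- z) x) by apply: ccontM => //; exact: ccont_wave.
have cSw : ccont (fun x => S N x * wave (- z) x) by apply: ccontM => //; exact: ccont_wave.
rewrite -(coefS N zN) -[- cint _]mulN1r -cintZ // -cintD //; last first.
  by apply: ccontM => //; exact: ccont_cst.
have -> : e = (e / 4 + e / 4) + (e / 4 + e / 4) by lra.
apply: cint_le.
  by apply: ccontD => //; apply: ccontM => //; exact: ccont_cst.
move=> x; rewrite mulN1r -mulrBl nrM.
have -> : nr (wave (- z) x) = 1.
  by rewrite /nr /wave /expi normc_def /= cos2Dsin2 sqrtr1.
rewrite mulr1 SE (_ : f x - _ = (trig a1 b1 x - series (fun n => trig_term a1 b1 n x) N) +i*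
  (trig a2 b2 x - series (fun n => trig_term a2 b2 n x) N)); last by [].
by apply: (le_trans (nr_complex _ _)); rewrite lerD // ?H1 ?H2.
Qed.

End Synthesis.

Unset Implicit Arguments.

Theorem theorem6p4 (R : realType) (H : completeNormedModType R[i])
    (dot : {dot H for Num.conj}) (Hdot : hilbert_norm dot)
    (E : nat -> H) (HE : orthonormal_basis dot E)
    (g : 'M[R[i]]_2) (Hg : SU11 g)
    (rho : (H -> H) -> (H -> H))
    (Hrho : star_automorphism dot (toeplitz_algebra dot E) rho)
    (HrhoU : rho (unilateral_shift E) = moebius_shift E g) :
  rho @` smooth_toeplitz dot E `<=` smooth_toeplitz dot E.
Proof.
have det1 := SU11_det Hg.
rewrite (shiftU_unilateral Hdot HE) (moebius_shiftE Hdot HE Hg) in HrhoU.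
move=> _ [_ [f [t [c [sf [bt ft] sc ->]]] <-]].
rewrite (toeplitz_partialE Hdot HE) in ft.
have [bc [cf [_ cc]]] := sc.
have Tt := tsum_toeplitz_lim Hdot HE bt ft.
have Tc := msum_toeplitz_lim Hdot HE bc cc.
have [h dh ht] := rho_toeplitz Hdot HE det1 Hrho HrhoU (fourier_decay sf) bt ft.
(* [is_toeplitz] sees a symbol only through its Fourier coefficients, so any smooth function with
   coefficients [h] is a symbol of [rho t]. *)
have [f' sf' ff'] := fourier_synthesis dh.
exists f', (rho t), (rho c); split => //.
- split; last by rewrite (toeplitz_partialE Hdot HE) ff'.
  have [M bM] : exists M, bop M (rho t).
    by apply: (toeplitz_bop Hdot HE); case: Hrho => -[+ _ _] _ _ _; apply.
  exact: bop_bounded bM.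
- exact: (rho_smooth_compact Hdot HE det1 Hrho HrhoU sc).
- exact: (rho_add Hrho Tt Tc).
Qed.
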